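(* Let $D=P+Q$, where $P=\prod_{j=1}^k(y-q^{l_j})$ with $l_1,\dots,l_k\in\mathbb{Z}$, and $Q\in t\,\mathbf{k}[q^{\pm1}](\!(x)\!)[y^{\pm1}][[t]]$. Then for any $M\ge1$ there exists $C_M$ such that $$\det(\rho_{n,\xi,\eta}(D))=(-1)^{k(n-1)}(q^{n\varepsilon}-1)^k\cdot\exp\Big(R_{n,\varepsilon}\,\mathrm{Coef}_{x^\varepsilon}\big(\rho_\varepsilon(\log(1+P^{-1}Q))x^\varepsilon\big)\Big)\Big|_{q^\varepsilon=\eta}\mod\Phi_n(q),\ t^M$$ for all $n>C_M$.
   Context: $\mathbf{k}$ is a field of characteristic zero and $t$ is a formal parameter. $A=\mathbf{k}\langle q^{\pm1},x^{\pm1},y^{\pm1}\rangle$ is the algebra with $q$ central and $yx=qxy$; $\bar A=\mathbf{k}\langle q^{\pm1},x^{\pm1},y^{\pm1},(y-q^j)^{-1},j\in\mathbb{Z}\rangle$. Elements of $\bar A$ are finite sums $\sum_jx^jf_j(y)$ with $f_j$ rational functions of $y$ whose denominators are monic with roots in $\{q^j:j\in\mathbb{Z}\}$, multiplied by the rule $f(y)x^j=x^jf(q^jy)$. The ring $\mathbf{k}[q^{\pm1}](\!(x)\!)[y^{\pm1}][[t]]$ consists of power series in $t$ whose coefficients are Laurent polynomials in $y$ with coefficients that are formal Laurent series in $x$ over $\mathbf{k}[q^{\pm1}]$, with the same commutation rule. $\Phi_n(q)\in\mathbb{Z}[q]$ is the $n$-th cyclotomic polynomial, and $n$ denotes a natural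 number. For $n\ge1$ and formal parameters $\xi,\eta$, $\rho_{n,\xi,\eta}$ is the $n$-dimensional representation of $\bar A/\Phi_n(q)$ with basis $\{v_j:j\in\mathbb{Z}/(n)\}$ given by $\rho_{n,\xi,\eta}(x)v_j=\xi v_{j+1}$, $\rho_{n,\xi,\eta}(y)v_j=q^j\eta v_j$. It is applied termwise to series in $x$ and $t$. For a formal variable $q^\varepsilon$ (with $q^{\varepsilon+m}=q^\varepsilon q^m$, $q^{m\varepsilon}=(q^\varepsilon)^m$ for $m\in\mathbb{Z}$), $\rho_\varepsilon$ is the representation of $\bar A$ on the $\mathbf{k}(q,q^\varepsilon)$-vector space with basis $\{x^{\varepsilon+m}:m\in\mathbb{Z}\}$ given by $\rho_\varepsilon(x)x^{\varepsilon+m}=x^{\varepsilon+m+1}$, $\rho_\varepsilon(y)x^{\varepsilon+m}=q^{\varepsilon+m}x^{\varepsilon+m}$, also applied termwise to series in $x$ and $t$; $\mathrm{Coef}_{x^\varepsilon}$ denotes the coefficient of $x^\varepsilon$. The logarithm is understood as a power series, and $R_{n,\varepsilon}$ is applied to the coefficient of each power of $t$. The linear operator $$R_{n,\varepsilon}:\mathbf{k}[q^{\pm1},q^{\pm\varepsilon},(1-q^{\varepsilon+j})^{-1},j\in\mathbb{Z}]\to\mathbf{k}[q^{\pm1},q^{n\varepsilon},(1-q^{n\varepsilon})^{-1},(q^i-1)^{-1},i\ge1]$$ is defined, via partial fraction decomposition with respect to the variable $q^\varepsilon$ (with coefficients functions of $q$; polynomials $q^i-1$ appear in denominators), by $R_{n,\varepsilon}(q^{j\varepsilon})=0$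 for $j\ne0$, $R_{n,\varepsilon}(1)=n$, and for $j>0$, $i\in\mathbb{Z}$ $$R_{n,\varepsilon}\Big(\frac1{(q^{\varepsilon+i}-1)^j}\Big)=\frac{nW_j(n,q^{n\varepsilon})}{(q^{n\varepsilon}-1)^j},\qquad \frac{nW_j(n,q^{n\varepsilon})}{(q^{n\varepsilon}-1)^j}:=\sum_{i=0}^{n-1}\frac1{(\mu^iq^\varepsilon-1)^j},$$ where $\mu$ is a primitive $n$-th root of unity; $W_j(n,u)$ is a polynomial in $u$ of degree $j-1$ whose coefficients are polynomials in $n$ taking integer values at integer $n$.
   Formalization: For Q infinite in x the identity fails at ξ^n (e.g. P=y-1, Q=t(y-1)Σx^i); so it is proved for all coefficients of ξ^a with a<n for every Q, and for all powers of ξ when each t-coefficient of Q below t^M has only finitely many powers of x. *)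

(* Defs.v *)
From HB Require Import structures.
From mathcomp Require Import all_boot all_order all_algebra.
From mathcomp Require Import all_field.
From mathcomp Require Import zify.
From mathcomp Require Import boolp classical_sets fsbigop.

Set Implicit Arguments.
Unset Strict Implicit.
Unset Printing Implicit Defensive.

Import Order.TTheory GRing.Theory Num.Theory.

Local Open Scope ring_scope.

(* Formal power series \sum_m (tcoef F m) t^m. *)
Record tseries (R : Type) := TSeries { tcoef : nat -> R }.

Lemma tseriesP (R : Type) (F G : tseries R) : tcoef F =1 tcoef G -> F = G.
Proof. by case: F G => [f] [g] /= /funext ->. Qed.

Section TSeries.
Variable R : nzRingType.
Implicit Types F G H : tseries R.

HB.instance Definition _ := gen_eqMixin (tseries R).
HB.instance Definition _ := gen_choiceMixin (tseries R).

Definition tadd F G : tseries R := TSeries (fun m => tcoef F m + tcoef G m).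
Definition topp F : tseries R := TSeries (fun m => - tcoef F m).
Definition tconst (c : R) : tseries R :=
  TSeries (fun m => if m == 0%N then c else 0).
Definition tmul F G : tseries R :=
  TSeries (fun m => \sum_(i < m.+1) tcoef F i * tcoef G (m - i)).

Let taddA : associative tadd.
Proof. by move=> F G H; apply: tseriesP => m; rewrite /= addrA. Qed.
Let taddC : commutative tadd.
Proof. by move=> F G; apply: tseriesP => m; rewrite /= addrC. Qed.
Let tadd0 : left_id (tconst 0) tadd.
Proof. by move=> F; apply: tseriesP => m; rewrite /= if_same add0r. Qed.
Let taddN : left_inverse (tconst 0) topp tadd.
Proof. by move=> F; apply: tseriesP => m; rewrite /= if_same addNr. Qed.

HB.instance Definition _ :=
  GRing.isZmodule.Build (tseries R) taddA taddC tadd0 taddN.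

Let trunc (m : nat) F : {poly R} := \poly_(i < m.+1) tcoef F i.

Let coef_trunc m F i : (i <= m)%N -> (trunc m F)`_i = tcoef F i.
Proof. by move=> im; rewrite coef_poly ltnS im. Qed.

Let tmul_trunc m F G i : (i <= m)%N ->
  tcoef (tmul F G) i = (trunc m F * trunc m G)`_i.
Proof.
move=> im; rewrite coefM; apply: eq_bigr => j _.
rewrite !coef_trunc ?(leq_trans _ im) ?leq_subr //.
by rewrite -ltnS.
Qed.

Let tmulA : associative tmul.
Proof.
move=> F G H; apply: tseriesP => m.
transitivity ((trunc m F * (trunc m G * trunc m H))`_m).
  rewrite coefM; apply: eq_bigr => i _.
  rewrite coef_trunc; last by rewrite -ltnS.
  by rewrite (@tmul_trunc m) // leq_subr.
rewrite mulrA coefM; apply: eq_bigr => i _.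
rewrite (coef_trunc _ (leq_subr _ _)) (@tmul_trunc m) //.
by rewrite -ltnS.
Qed.

Let tmul1l : left_id (tconst 1) tmul.
Proof.
move=> F; apply: tseriesP => m; rewrite /= big_ord_recl /= mul1r subn0.
by rewrite big1 ?addr0 // => i _; rewrite mul0r.
Qed.

Let tmul1r : right_id (tconst 1) tmul.
Proof.
move=> F; apply: tseriesP => m; rewrite /= big_ord_recr /= subnn mulr1.
rewrite big1 ?add0r // => i _.
by rewrite subn_eq0 leqNgt ltn_ord mulr0.
Qed.

Let tmulDl : left_distributive tmul tadd.
Proof.
move=> F G H; apply: tseriesP => m; rewrite /= -big_split /=.
by apply: eq_bigr => i _; rewrite -mulrDl.
Qed.

Let tmulDr : right_distributive tmul tadd.
Proof.
move=> F G H; apply: tseriesP => m; rewrite /= -big_split /=.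
by apply: eq_bigr => i _; rewrite -mulrDr.
Qed.

Let tone_neq0 : tconst 1 != 0.
Proof.
by apply/eqP => /(congr1 (fun F => tcoef F 0)); apply/eqP; rewrite /= oner_neq0.
Qed.

HB.instance Definition _ := GRing.Zmodule_isNzRing.Build (tseries R)
  tmulA tmul1l tmul1r tmulDl tmulDr tone_neq0.

End TSeries.

Section TSeriesCom.
Variable R : comNzRingType.

Let tmulC : commutative (@tmul R).
Proof.
move=> F G; apply: tseriesP => m /=.
rewrite (reindex_inj rev_ord_inj) /=; apply: eq_bigr => i _.
by rewrite mulrC subSS subKn // -ltnS.
Qed.

HB.instance Definition _ :=
  GRing.PzSemiRing_hasCommutativeMul.Build (tseries R) tmulC.

End TSeriesCom.

(* An action of the powers of x on the coefficients: [tau l c] is the element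
   such that c x^l = x^l (tau l c). *)
Record twist (R : nzRingType) := Twist {
  tw :> int -> {rmorphism R -> R};
  tw0 : forall c, tw 0 c = c;
  twD : forall a b c, tw (a + b) c = tw a (tw b c) }.

(* Formal Laurent series \sum_a x^a c_a, coefficients written on the right. *)
Record laurent (R : nzRingType) (tau : twist R) := Laurent {
  lcoef : int -> R;
  lcoef_bounded : exists N : int, forall a : int, a < N -> lcoef a = 0 }.

Lemma laurentP (R : nzRingType) (tau : twist R) (f g : laurent tau) :
  lcoef f =1 lcoef g -> f = g.
Proof.
case: f g => [f fP] [g gP] /= /funext fg; case: _ / fg gP => gP.
by congr Laurent; apply: Prop_irrelevance.
Qed.

Section LaurentRing.
Variables (R : nzRingType) (tau : twist R).
Implicit Types f g h : laurent tau.

HB.instance Definition _ := gen_eqMixin (laurent tau).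
HB.instance Definition _ := gen_choiceMixin (laurent tau).

Fact ladd_subproof f g : exists N : int, forall a : int, a < N ->
  lcoef f a + lcoef g a = 0.
Proof.
have [Nf fN] := lcoef_bounded f; have [Ng gN] := lcoef_bounded g.
exists (Num.min Nf Ng) => a; rewrite lt_min => /andP[aNf aNg].
by rewrite fN // gN // addr0.
Qed.
Definition ladd f g : laurent tau := Laurent tau (ladd_subproof f g).

Fact lopp_subproof f : exists N : int, forall a : int, a < N -> - lcoef f a = 0.
Proof.
by have [N fN] := lcoef_bounded f; exists N => a aN; rewrite fN ?oppr0.
Qed.
Definition lopp f : laurent tau := Laurent tau (lopp_subproof f).

Fact lconst_subproof (c : R) : exists N : int, forall a : int, a < N ->
  (if a == 0 then c else 0) = 0.
Proof. by exists 0 => a a0; rewrite lt_eqF. Qed.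
Definition lconst (c : R) : laurent tau := Laurent tau (lconst_subproof c).

Let window (N : nat) : seq int := [seq i%:Z - N%:Z | i <- iota 0 N.*2.+1].

Let window_uniq N : uniq (window N).
Proof. by rewrite map_inj_uniq ?iota_uniq // => i j; lia. Qed.

Let mem_window N (l : int) : - N%:Z <= l -> l <= N%:Z -> l \in window N.
Proof.
move=> l1 l2; apply/mapP; exists `|(l + N%:Z)%R|%N; last by lia.
by rewrite mem_iota; lia.
Qed.

Let fsum_window N (F : int -> R) :
  (forall l, F l <> 0 -> - N%:Z <= l /\ l <= N%:Z) ->
  \sum_(l \in [set: int]) F l = \sum_(l <- window N) F l.
Proof.
move=> FN; rewrite (fsbigE (window N)) //; first last.
- move=> l _; apply: contraNeq => /eqP /FN[].
  exact: mem_window.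
- by apply: eq_bigl => l; rewrite in_setT.
Qed.

Let bound f : exists N : nat, forall a, lcoef f a <> 0 -> - N%:Z <= a.
Proof.
have [N fN] := lcoef_bounded f; exists `|N|%N => a fa.
rewrite leNgt; apply/negP => aN; apply: fa; apply: fN; lia.
Qed.

Let bound3 f g h : exists N : nat, [/\
  forall a, lcoef f a <> 0 -> - N%:Z <= a,
  forall a, lcoef g a <> 0 -> - N%:Z <= a &
  forall a, lcoef h a <> 0 -> - N%:Z <= a].
Proof.
have [[Nf fN] [Ng gN] [Nh hN]] := And3 (bound f) (bound g) (bound h).
exists (Nf + Ng + Nh)%N.
by split=> a; [move=> /fN|move=> /gN|move=> /hN]; lia.
Qed.

Let term f g (a l : int) : R := tau l (lcoef f (a - l)) * lcoef g l.

Let term_neq0 f g a l : term f g a l <> 0 ->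
  lcoef f (a - l) <> 0 /\ lcoef g l <> 0.
Proof.
rewrite /term => h; split=> e; apply: h; first by rewrite e rmorph0 mul0r.
by rewrite e mulr0.
Qed.

Fact lmul_subproof f g : exists N : int, forall a : int, a < N ->
  \sum_(l \in [set: int]) tau l (lcoef f (a - l)) * lcoef g l = 0.
Proof.
have [N [fN gN _]] := bound3 f g g; exists (- (N + N)%:Z) => a aN.
rewrite fsbig1 // => l _; apply: contrapT => /term_neq0[/fN ? /gN ?]; lia.
Qed.
(* (x^b f_b)(x^l g_l) = x^(b+l) (tau l f_b) g_l; the sum has finite support. *)
Definition lmul f g : laurent tau := Laurent tau (lmul_subproof f g).

Let lmulE N B f g (a : int) :
  (forall a, lcoef f a <> 0 -> - N%:Z <= a) ->
  (forall a, lcoef g a <> 0 -> - N%:Z <= a) ->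
  (N <= B)%N -> a + N%:Z <= B%:Z ->
  lcoef (lmul f g) a = \sum_(l <- window B) term f g a l.
Proof.
move=> fN gN NB aB; apply: fsum_window => l /term_neq0[/fN ? /gN ?]; lia.
Qed.

Let laddA : associative ladd.
Proof. by move=> f g h; apply: laurentP => a; rewrite /= addrA. Qed.
Let laddC : commutative ladd.
Proof. by move=> f g; apply: laurentP => a; rewrite /= addrC. Qed.
Let ladd0 : left_id (lconst 0) ladd.
Proof. by move=> f; apply: laurentP => a; rewrite /= if_same add0r. Qed.
Let laddN : left_inverse (lconst 0) lopp ladd.
Proof. by move=> f; apply: laurentP => a; rewrite /= if_same addNr. Qed.

HB.instance Definition _ :=
  GRing.isZmodule.Build (laurent tau) laddA laddC ladd0 laddN.

Let lmulA : associative lmul.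
Proof.
move=> f g h; apply: laurentP => a.
have [N [fN gN hN]] := bound3 f g h.
pose B := (`|a| + 4 * N)%N.
have fgN b : lcoef (lmul f g) b <> 0 -> - (N + N)%:Z <= b.
  move=> fgb; rewrite leNgt; apply/negP => bN; apply: fgb.
  rewrite /= fsbig1 // => l _; apply: contrapT => /term_neq0[/fN ? /gN ?]; lia.
have ghN b : lcoef (lmul g h) b <> 0 -> - (N + N)%:Z <= b.
  move=> fgb; rewrite leNgt; apply/negP => bN; apply: fgb.
  rewrite /= fsbig1 // => l _; apply: contrapT => /term_neq0[/gN ? /hN ?]; lia.
have -> : lcoef (lmul f (lmul g h)) a = \sum_(s <- window B)
    \sum_(l <- window B) tau s (lcoef f (a - s)) * term g h s l.
  rewrite (@lmulE (N + N) B).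
  - apply: eq_bigr => s _; rewrite -mulr_sumr.
    have [e|/eqP/fN sN] := eqVneq (lcoef f (a - s)) 0.
      by rewrite /term e rmorph0 !mul0r.
    rewrite /term (@lmulE N B) //; rewrite /B; lia.
  - by move=> b /fN; lia.
  - exact: ghN.
  - by rewrite /B; lia.
  - by rewrite /B; lia.
rewrite exchange_big (@lmulE (N + N) B); first last.
- by rewrite /B; lia.
- by rewrite /B; lia.
- by move=> b /hN; lia.
- exact: fgN.
apply: eq_bigr => l _; rewrite {2}/term.
under eq_bigr do rewrite /term mulrA.
rewrite -mulr_suml.
have [->|/eqP/hN lN] := eqVneq (lcoef h l) 0; first by rewrite !mulr0.
congr (_ * _); rewrite (@lmulE N B) //; [|by rewrite /B; lia..].
pose F s := tau s (lcoef f (a - s)) * tau l (lcoef g (s - l)).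
transitivity (\sum_(s \in [set: int]) F s).
  symmetry; apply: fsum_window => s Fs.
  have /fN ? : lcoef f (a - s) <> 0.
    by move=> e; apply: Fs; rewrite /F e rmorph0 mul0r.
  have /gN ? : lcoef g (s - l) <> 0.
    by move=> e; apply: Fs; rewrite /F e rmorph0 mulr0.
  by rewrite /B; lia.
have bij : bijective (fun p : int => p + l).
  by exists (fun p => p - l) => p; rewrite ?addrK ?subrK.
rewrite (reindex_fsbigT _ _ bij) rmorph_sum (@fsum_window B).
  apply: eq_bigr => p _; rewrite /F /term rmorphM -twD addrK [l + p]addrC.
  by congr (tau _ (lcoef f _) * _); lia.
move=> p Fp.
have /fN ? : lcoef f (a - (p + l)) <> 0.
  by move=> e; apply: Fp; rewrite /F e rmorph0 mul0r.
have /gN ? : lcoef g (p + l - l) <> 0.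
  by move=> e; apply: Fp; rewrite /F e rmorph0 mulr0.
by rewrite /B; lia.
Qed.

Let lmul1l : left_id (lconst 1) lmul.
Proof.
move=> f; apply: laurentP => a /=.
rewrite (fsbigE [:: a]) //; last first.
  move=> l _; rewrite inE => la; rewrite ifF ?rmorph0 ?mul0r //.
  by apply/negbTE; rewrite subr_eq0 eq_sym.
by rewrite big_mkcond big_seq1 in_setT subrr eqxx rmorph1 mul1r.
Qed.

Let lmul1r : right_id (lconst 1) lmul.
Proof.
move=> f; apply: laurentP => a /=.
rewrite (fsbigE [:: 0]) //; last first.
  by move=> l _; rewrite inE => /negbTE ->; rewrite mulr0.
by rewrite big_mkcond big_seq1 in_setT eqxx mulr1 subr0 tw0.
Qed.

Let lmulDl : left_distributive lmul ladd.
Proof.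
move=> f g h; apply: laurentP => a.
have [N [fN gN hN]] := bound3 f g h.
pose B := (`|a| + 4 * N)%N.
have fgN b : lcoef (ladd f g) b <> 0 -> - N%:Z <= b.
  move=> fgb; rewrite leNgt; apply/negP => bN; apply: fgb => /=.
  have -> : lcoef f b = 0 by apply: contrapT => /fN; lia.
  have -> : lcoef g b = 0 by apply: contrapT => /gN; lia.
  by rewrite addr0.
transitivity (lcoef (lmul f h) a + lcoef (lmul g h) a); last by [].
rewrite !(@lmulE N B) //; [|by rewrite /B; lia..].
rewrite -big_split; apply: eq_bigr => l _ /=.
by rewrite /term /= rmorphD mulrDl.
Qed.

Let lmulDr : right_distributive lmul ladd.
Proof.
move=> f g h; apply: laurentP => a.
have [N [fN gN hN]] := bound3 f g h.
pose B := (`|a| + 4 * N)%N.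
have ghN b : lcoef (ladd g h) b <> 0 -> - N%:Z <= b.
  move=> fgb; rewrite leNgt; apply/negP => bN; apply: fgb => /=.
  have -> : lcoef g b = 0 by apply: contrapT => /gN; lia.
  have -> : lcoef h b = 0 by apply: contrapT => /hN; lia.
  by rewrite addr0.
transitivity (lcoef (lmul f g) a + lcoef (lmul f h) a); last by [].
rewrite !(@lmulE N B) //; [|by rewrite /B; lia..].
rewrite -big_split; apply: eq_bigr => l _ /=.
by rewrite /term /= mulrDr.
Qed.

Let lone_neq0 : lconst 1 != 0.
Proof.
by apply/eqP => /(congr1 (fun f => lcoef f 0)); apply/eqP; rewrite /= oner_neq0.
Qed.

HB.instance Definition _ := GRing.Zmodule_isNzRing.Build (laurent tau)
  lmulA lmul1l lmul1r lmulDl lmulDr lone_neq0.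

End LaurentRing.

Program Definition notwist (R : nzRingType) : twist R :=
  @Twist R (fun _ => idfun) _ _.

Section LaurentCom.
Variable R : comNzRingType.

Let lmulC : commutative (@lmul R (notwist R)).
Proof.
move=> f g; apply: laurentP => a /=.
have bij : bijective (fun l : int => a - l).
  by exists (fun l => a - l) => l; lia.
rewrite (reindex_fsbigT _ _ bij); apply: eq_fsbigr => l _ /=.
by rewrite mulrC (_ : a - (a - l) = l) //; lia.
Qed.

HB.instance Definition _ :=
  GRing.PzSemiRing_hasCommutativeMul.Build (laurent (notwist R)) lmulC.

End LaurentCom.

Local Notation "x %:F" := (@FracField.tofrac _ x).

Section Scale.
Variable F : fieldType.
Implicit Types (c : F) (p : {poly F}) (z : {fraction {poly F}}).

Definition scale_poly c p : {poly F} := p \Po (c *: 'X).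

(* f(y) |-> f(c y) on rational functions of y; c must be nonzero. *)
Definition scale_frac c z : {fraction {poly F}} :=
  (scale_poly c (\n_(repr z)))%:F / (scale_poly c (\d_(repr z)))%:F.

Lemma scale_poly_eq0 c p : c != 0 -> (scale_poly c p == 0) = (p == 0).
Proof.
move=> c0; rewrite /scale_poly -!size_poly_eq0 size_comp_poly2 //.
by rewrite size_scale // size_polyX.
Qed.

Lemma frac_numden z : z = (\n_(repr z))%:F / (\d_(repr z))%:F.
Proof.
have d0 := denom_ratioP (repr z).
apply: (mulIf (x := (\d_(repr z))%:F)); first by rewrite tofrac_eq0.
rewrite divfK ?tofrac_eq0 //.
rewrite -[X in X * _ = _]reprK; unlock FracField.tofrac; rewrite piE.
apply/eqmodP => /=; rewrite FracField.equivfE /FracField.mulf.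
by rewrite !numden_Ratio ?mulf_neq0 ?oner_neq0 // !mulr1 mulrC.
Qed.

Lemma scale_fracE c p r : c != 0 -> r != 0 ->
  scale_frac c (p%:F / r%:F) = (scale_poly c p)%:F / (scale_poly c r)%:F.
Proof.
move=> c0 r0; rewrite /scale_frac; set z := p%:F / r%:F.
have d0 := denom_ratioP (repr z).
have := frac_numden z; rewrite {1}/z => /eqP.
rewrite eqr_div ?tofrac_eq0 // -!tofracM tofrac_eq => /eqP e.
apply/eqP; rewrite eqr_div ?tofrac_eq0 ?scale_poly_eq0 //.
by rewrite -!tofracM tofrac_eq /scale_poly -!comp_polyM e.
Qed.

Section Morphism.
Variable c : F.
Hypothesis c0 : c != 0.

Lemma scale_frac_poly p : scale_frac c p%:F = (scale_poly c p)%:F.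
Proof.
rewrite -[p%:F]divr1 -tofrac1 scale_fracE ?oner_neq0 //.
by rewrite /scale_poly rmorph1 tofrac1 divr1.
Qed.

Lemma scale_frac_zmod_morphism : zmod_morphism (scale_frac c).
Proof.
move=> u v; rewrite [u]frac_numden [v]frac_numden.
have du := denom_ratioP (repr u); have dv := denom_ratioP (repr v).
rewrite -mulNr addf_div ?tofrac_eq0 // -!tofracN -!tofracM -tofracD.
rewrite !scale_fracE ?mulf_neq0 // -mulNr addf_div ?tofrac_eq0 ?scale_poly_eq0 //.
rewrite -!tofracN -!tofracM -tofracD /scale_poly.
rewrite comp_polyD !comp_polyM.
by rewrite (raddfN (comp_poly (c *: 'X))).
Qed.

Lemma scale_frac_monoid_morphism : monoid_morphism (scale_frac c).
Proof.
split=> [|u v].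
  by rewrite -tofrac1 scale_frac_poly /scale_poly rmorph1.
rewrite [u]frac_numden [v]frac_numden.
have du := denom_ratioP (repr u); have dv := denom_ratioP (repr v).
rewrite mulf_div -!tofracM !scale_fracE ?mulf_neq0 // mulf_div -!tofracM.
by rewrite /scale_poly !comp_polyM.
Qed.

Definition scale_morph : {rmorphism {fraction {poly F}} -> {fraction {poly F}}} :=
  HB.pack (scale_frac c)
    (GRing.isZmodMorphism.Build _ _ (scale_frac c) scale_frac_zmod_morphism)
    (GRing.isMonoidMorphism.Build _ _ (scale_frac c) scale_frac_monoid_morphism).

End Morphism.

End Scale.

(* k(q), and k(q)(y). The variable of the latter plays the role of y, of the
   formal parameter eta and of the formal variable q^eps. *)
Notation ratq k := {fraction {poly k}}.
Notation ratqy k := {fraction {poly ratq k}}.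

Section QAlgebra.
Variable k : fieldType.

Definition qv : ratq k := 'X%:F.
Definition qc (c : ratq k) : ratqy k := (c%:P)%:F.
Definition yv : ratqy k := 'X%:F.

Lemma qv_neq0 : qv != 0.
Proof. by rewrite tofrac_eq0 polyX_eq0. Qed.

Lemma scale_frac1 (f : ratqy k) : scale_frac (qv ^ 0) f = f.
Proof.
by rewrite expr0z [f]frac_numden scale_fracE ?oner_neq0 ?denom_ratioP //
  /scale_poly scale1r !comp_polyXr.
Qed.

Lemma scale_fracD (a b : int) (f : ratqy k) :
  scale_frac (qv ^ (a + b)) f = scale_frac (qv ^ a) (scale_frac (qv ^ b) f).
Proof.
have q0 i : qv ^ i != 0 by rewrite expfz_neq0 // qv_neq0.
have := frac_numden f; have := denom_ratioP (repr f).
move: (\n_(repr f)) (\d_(repr f)) => u v v0 ->.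
rewrite (scale_fracE u (q0 (a + b)) v0) (scale_fracE u (q0 b) v0).
rewrite scale_fracE ?scale_poly_eq0 // /scale_poly.
have sD (p : {poly ratq k}) :
    p \Po (qv ^ (a + b) *: 'X) = (p \Po (qv ^ b *: 'X)) \Po (qv ^ a *: 'X).
  rewrite -comp_polyA comp_polyZ comp_polyX scalerA.
  congr (_ \Po (_ *: 'X)).
  by rewrite [a + b]addrC expfzDr // qv_neq0.
by rewrite (sD u) (sD v).
Qed.

(* f(y) x^l = x^l f(q^l y) *)
Definition qtwist : twist (ratqy k) :=
  @Twist _ (fun l => scale_morph (expfz_neq0 l qv_neq0)) scale_frac1 scale_fracD.

(* Power series in t whose coefficients are series \sum_a x^a f_a(y); this
   contains \bar A and k[q^{+-1}]((x))[y^{+-1}][[t]]. *)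
Definition qseries := tseries (laurent qtwist).

Definition qseries_const (f : ratqy k) : qseries := tconst (lconst qtwist f).

Definition is_laurent_q (c : ratq k) : Prop :=
  exists (p : {poly k}) (e : nat), c = p%:F / qv ^+ e.

(* f is a Laurent polynomial in y over k[q^{+-1}], degrees within [-N, N]. *)
Definition is_laurent_qy (N : nat) (f : ratqy k) : Prop :=
  exists p : {poly ratq k}, [/\ (size p <= N.*2.+1)%N,
    forall i, is_laurent_q p`_i & f = p%:F / yv ^+ N].

(* k[q^{+-1}]((x))[y^{+-1}]: the y-degree is bounded independently of the
   power of x, the q-degrees are not. *)
Definition laurent_xy (G : laurent qtwist) : Prop :=
  exists N : nat, forall a : int, is_laurent_qy N (lcoef G a).

(* rho_n(x^a f(y)) has trace xi^a \sum_j f(q^j eta) when n divides a. If a is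
   not bounded above, this produces powers xi^n, xi^(2n), ... in determinants
   for every n. *)
Definition finite_in_x (G : laurent qtwist) : Prop :=
  exists N : int, forall a : int, N < a -> lcoef G a = 0.

(* log(1 + G), for G without constant term in t. *)
Definition log1p (G : qseries) : qseries :=
  TSeries (fun m => \sum_(1 <= r < m.+1)
    lconst qtwist ((-1) ^+ r.+1 / r%:R) * tcoef (G ^+ r) m).

(* exp S, for S without constant term in t. *)
Definition texp (S : tseries (ratqy k)) : tseries (ratqy k) :=
  TSeries (fun m => \sum_(0 <= r < m.+1) (r`!%:R)^-1 * tcoef (S ^+ r) m).

(* The coefficient of x^(eps+p) in rho_eps(G) x^(eps+m), q^eps being yv. *)
Definition rho_eps (G : laurent qtwist) (m p : int) : ratqy k :=
  qtwist m (lcoef G (p - m)).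

Definition coef_x_eps (G : laurent qtwist) : ratqy k := rho_eps G 0 0.

(* xi-series over k(q)(eta). *)
Definition xiseries := laurent (notwist (ratqy k)).

Fact rho_subproof (n : nat) (G : laurent qtwist) (i j : 'I_n) :
  exists N : int, forall a : int, a < N ->
    (if (i%:Z == j%:Z + a %[mod n%:Z])%Z then qtwist j%:Z (lcoef G a) else 0)
    = 0.
Proof.
have [N GN] := lcoef_bounded G; exists N => a /GN ->.
by rewrite rmorph0 if_same.
Qed.

(* x^a f(y) acts by v_j |-> xi^a f(q^j eta) v_(j+a); column j is the image of
   v_j. The entries are written for a generic q, using the representatives
   0 <= j < n; this is a representation only modulo Phi_n(q). *)
Definition rho (n : nat) (G : qseries) : 'M[tseries xiseries]_n :=
  \matrix_(i, j) TSeries (fun m =>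
    Laurent (notwist _) (rho_subproof (tcoef G m) i j)).

End QAlgebra.

(* W_j(n,u), characterised by
   n W_j(n,u^n) / (u^n - 1)^j = \sum_(i < n) 1 / (mu^i u - 1)^j. *)
Definition W_spec (n j : nat) (W : {poly int}) : Prop :=
  exists mu : algC, n.-primitive_root mu /\
    n%:R * ((map_poly intr W : {poly algC}) \Po 'X^n)%:F / ('X^n - 1)%:F ^+ j
    = \sum_(i < n) ((mu ^+ i *: 'X - 1 : {poly algC})%:F ^+ j)^-1.

Definition W (n j : nat) : {poly int} := xget 0 [set w | W_spec n j w].

Section Operators.
Variable k : fieldType.
Local Notation q := (qv k).
Local Notation y := (yv k).

(* A partial fraction in u = q^eps: (i, c) in the first list stands for
   c u^i and (i, j, c) in the second one for c / (q^i u - 1)^(j+1). *)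
Definition pfrac : Type := (seq (int * ratq k) * seq (int * nat * ratq k))%type.

Definition pfrac_val (d : pfrac) : ratqy k :=
  \sum_(z <- d.1) qc z.2 * y ^ z.1
  + \sum_(z <- d.2) qc z.2 / (qc (q ^ z.1.1) * y - 1) ^+ z.1.2.+1.

Definition pfrac_R (n : nat) (d : pfrac) : ratqy k :=
  \sum_(z <- d.1) qc z.2 * (if z.1 == 0 then n%:R else 0)
  + \sum_(z <- d.2) qc z.2 *
      (n%:R * (map_poly intr (W n z.1.2.+1)).[y ^+ n]
       / (y ^+ n - 1) ^+ z.1.2.+1).

(* R_{n,eps}; the junk value 0 is taken outside its domain. *)
Definition R_eps (n : nat) (f : ratqy k) : ratqy k :=
  pfrac_R n (xget ([::], [::]) [set d | pfrac_val d = f]).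

Definition Phi (n : nat) : {poly k} := map_poly intr 'Phi_n.

(* f belongs to k[q, eta^{+-1}, (eta^n - 1)^-1] localised at the polynomials
   in q coprime to Phi_n, where reduction modulo Phi_n(q) makes sense. *)
Definition Phi_integral (n : nat) (f : ratqy k) : Prop :=
  exists (a : {poly {poly k}}) (c : {poly k}) (d e : nat),
    coprimep c (Phi n) /\
    f = (map_poly (@FracField.tofrac _) a)%:F
        / (qc c%:F * y ^+ d * (y ^+ n - 1) ^+ e).

Definition Phi_congr (n : nat) (f g : ratqy k) : Prop :=
  [/\ Phi_integral n f, Phi_integral n g &
    exists2 h, Phi_integral n h & f - g = qc (Phi n)%:F * h].

(* Congruence modulo Phi_n(q) and t^M of the coefficients of xi^a, a in X. *)
Definition eq_mod (n M : nat) (X : set int) (G H : tseries (xiseries k)) :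
    Prop :=
  forall (m : nat) (a : int), (m < M)%N -> X a ->
    Phi_congr n (lcoef (tcoef G m) a) (lcoef (tcoef H m) a).

(* Series in t over k(q)(eta), as series with only xi^0. *)
Definition xi0 (S : tseries (ratqy k)) : tseries (xiseries k) :=
  TSeries (fun m => lconst (notwist _) (tcoef S m)).

Definition Pprod (r : nat) (l : 'I_r -> int) : ratqy k :=
  \prod_(j < r) (y - qc (q ^ l j)).

(* The right-hand side, with eta = q^eps = yv. *)
Definition det_formula (r n : nat) (l : 'I_r -> int) (Q : qseries k) :
    tseries (ratqy k) :=
  let L := log1p (qseries_const (Pprod l)^-1 * Q) in
  tconst ((-1) ^+ (r * n.-1) * (y ^+ n - 1) ^+ r)
  * texp (TSeries (fun m => R_eps n (coef_x_eps (tcoef L m)))).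

End Operators.

(* Main.v *)
(* Since k has characteristic 0, Phi_n is separable, so an element integral at
   Phi_n is divisible by Phi_n as soon as it vanishes at q = z for every root z of
   Phi_n in every extension L of k. At such a z, a primitive n-th root of unity,
   rho_n becomes a ring morphism rho to matrices of series over L(eta), and
     det rho(P + Q) = det rho(P) det(1 + rho(G)),   G = P^-1 Q.
   Jacobi's formula for t d/dt shows that the t-coefficients of det(1 + rho(G))
   satisfy the recursion of those of exp(tr log(1 + rho(G))). The trace of
   rho(x^a f(y)) vanishes unless n divides a, and since the x-degree of the t^m term
   is at least -mN for a fixed N, only a = 0 matters below xi^n when n > MN. For
   a = 0 the trace is the sum of f(z^j eta) over j < n, which turns partial
   fractions in y into those in the definition of R_{n,eps}, provided that no
   exponent of y is a nonzero multiple of n and that the denominators q^i - 1 are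
   coprime to Phi_n: this holds for n large, as only finitely many coefficients
   are involved modulo t^M. *)
Require Import Defs.
From HB Require Import structures.
From mathcomp Require Import all_boot all_order all_algebra all_field.
From mathcomp Require Import ring zify.
From mathcomp Require Import boolp classical_sets fsbigop.

Set Implicit Arguments.
Unset Strict Implicit.
Unset Printing Implicit Defensive.

Import Order.TTheory GRing.Theory Num.Theory.

Local Open Scope classical_set_scope.
Local Open Scope ring_scope.

Local Notation "x %:F" := (@FracField.tofrac _ x).

(** * Relations compatible with the ring operations *)

(** Specialisation at q = z is defined on only part of k(q)(y), so it is kept as a relation,
    [place], instead of a map. Whatever has to be carried along (specialisation, integrality,
    existence of a partial fraction with controlled coefficients, shape of the ξ-exponents) is
    closed under the ring operations; casting each as a [ring_rel] lets the same few lemmas lift it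
    to Laurent series, series in t, powers and determinants. No identity between exp and log is
    used: both sides are compared through a recursion expressing m c_m by earlier c_i, which
    determines c_m because m is invertible. Such a recursion stays below t^M, so the hypotheses on
    supports and on [R_eps] are required only there. Phi_n may be reducible over k, hence the
    quantification over all its roots in all extensions. [R_eps] and [W] are defined by choice.
    Before anything can be computed with them, uniqueness is needed: linear independence of partial
    fractions over k(q) for [R_eps], injectivity of substituting u^n for u in polynomials for
    [W]. *)

(* A predicate closed under the ring operations is a [ring_rel] that ignores its
   second argument. *)
Record ring_rel (R S : nzRingType) (rel : R -> S -> Prop) : Prop := RingRel {
  rel0 : rel 0 0;
  rel1 : rel 1 1;
  relN : forall a b, rel a b -> rel (- a) (- b);
  relD : forall a b c d, rel a b -> rel c d -> rel (a + c) (b + d);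
  relM : forall a b c d, rel a b -> rel c d -> rel (a * c) (b * d) }.

Section RingRel.
Variables (R S : nzRingType) (rel : R -> S -> Prop).
Hypothesis relP : ring_rel rel.

Lemma rel_sum (I : Type) (r : seq I) (P : pred I) (F : I -> R) (G : I -> S) :
  (forall i, P i -> rel (F i) (G i)) ->
  rel (\sum_(i <- r | P i) F i) (\sum_(i <- r | P i) G i).
Proof. by move=> FG; apply: big_ind2 => //; [apply: rel0|apply: relD]. Qed.

Lemma rel_prod (I : Type) (r : seq I) (P : pred I) (F : I -> R) (G : I -> S) :
  (forall i, P i -> rel (F i) (G i)) ->
  rel (\prod_(i <- r | P i) F i) (\prod_(i <- r | P i) G i).
Proof. by move=> FG; apply: big_ind2 => //; [apply: rel1|apply: relM]. Qed.

Lemma rel_exp a b i : rel a b -> rel (a ^+ i) (b ^+ i).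
Proof.
move=> ab; elim: i => [|i IHi]; first exact: rel1.
by rewrite !exprS; apply: relM.
Qed.

Lemma relMn a b i : rel a b -> rel (a *+ i) (b *+ i).
Proof.
move=> ab; elim: i => [|i IHi]; first exact: rel0.
by rewrite !mulrS; apply: relD.
Qed.

Lemma rel_nat i : rel i%:R i%:R.
Proof. by apply: relMn; apply: rel1. Qed.

Lemma rel_sign i : rel ((-1) ^+ i) ((-1) ^+ i).
Proof. by apply: rel_exp; apply: relN => //; apply: rel1. Qed.

End RingRel.

Lemma rel_det (R S : comNzRingType) (rel : R -> S -> Prop) n
    (A : 'M[R]_n) (B : 'M[S]_n) :
  ring_rel rel -> (forall i j, rel (A i j) (B i j)) -> rel (\det A) (\det B).
Proof.
move=> relP AB; apply: rel_sum => // s _; apply: relM => //.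
  exact: rel_sign.
by apply: rel_prod.
Qed.

Definition tseries_rel (R S : Type) (rel : R -> S -> Prop)
    (F : tseries R) (G : tseries S) : Prop :=
  forall m, rel (tcoef F m) (tcoef G m).

Definition laurent_rel (R S : nzRingType) (tau : twist R) (sigma : twist S)
    (rel : R -> S -> Prop) (f : laurent tau) (g : laurent sigma) : Prop :=
  forall a, rel (lcoef f a) (lcoef g a).

(** * Coefficients of series in t and of Laurent series *)

Section TSeriesTheory.
Variable R : nzRingType.
Implicit Types F G : tseries R.

Lemma tcoefD F G m : tcoef (F + G) m = tcoef F m + tcoef G m.
Proof. by []. Qed.

Lemma tcoefN F m : tcoef (- F) m = - tcoef F m.
Proof. by []. Qed.

Lemma tcoef0 m : tcoef (0 : tseries R) m = 0.
Proof. exact: if_same. Qed.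

Lemma tcoef1 m : tcoef (1 : tseries R) m = (m == 0%N)%:R.
Proof. by rewrite /GRing.one /=; case: eqP. Qed.

Lemma tcoefM F G m :
  tcoef (F * G) m = \sum_(i < m.+1) tcoef F i * tcoef G (m - i).
Proof. by []. Qed.

Lemma tcoefM0 F G : tcoef (F * G) 0 = tcoef F 0 * tcoef G 0.
Proof. by rewrite tcoefM big_ord1. Qed.

Lemma tcoef_sum (I : Type) (r : seq I) (P : pred I) (F : I -> tseries R) m :
  tcoef (\sum_(i <- r | P i) F i) m = \sum_(i <- r | P i) tcoef (F i) m.
Proof. by apply: (big_morph (fun F => tcoef F m)) => //; apply: tcoef0. Qed.

Lemma tcoefMn F i m : tcoef (F *+ i) m = tcoef F m *+ i.
Proof.
by elim: i => [|i IHi]; rewrite ?mulr0n ?tcoef0 // !mulrS -IHi tcoefD.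
Qed.

Lemma tcoef_constM c F m : tcoef (tconst c * F) m = c * tcoef F m.
Proof.
rewrite tcoefM big_ord_recl /= subn0 big1 ?addr0 // => i _.
by rewrite mul0r.
Qed.

Lemma tconstM (c d : R) : tconst (c * d) = tconst c * tconst d.
Proof.
by apply: tseriesP => m; rewrite tcoef_constM /=; case: eqP; rewrite ?mulr0.
Qed.

Lemma tconst1 : tconst (1 : R) = 1.
Proof. by []. Qed.

Lemma tcoef_exp_small F r m :
  tcoef F 0 = 0 -> (m < r)%N -> tcoef (F ^+ r) m = 0.
Proof.
move=> F0; elim: r m => [//|r IHr] m mr.
rewrite exprS tcoefM big1 // => i _.
have [->|i0] := posnP i; first by rewrite F0 mul0r.
by rewrite IHr ?mulr0 //; have := ltn_ord i; lia.
Qed.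

End TSeriesTheory.

Lemma tseries_relP (R S : nzRingType) (rel : R -> S -> Prop) :
  ring_rel rel -> ring_rel (tseries_rel rel).
Proof.
move=> relP; split.
- by move=> m; rewrite !tcoef0; exact: (rel0 relP).
- by move=> m; rewrite !tcoef1; exact: (rel_nat relP).
- by move=> F G FG m; rewrite !tcoefN; exact: (relN relP).
- by move=> F G F' G' FG FG' m; rewrite !tcoefD; exact: (relD relP).
- move=> F G F' G' FG FG' m; rewrite !tcoefM.
  by apply: (rel_sum relP) => i _; apply: (relM relP).
Qed.

Section LaurentTheory.
Variables (R : nzRingType) (tau : twist R).
Implicit Types f g : laurent tau.

Lemma lcoefD f g a : lcoef (f + g) a = lcoef f a + lcoef g a.
Proof. by []. Qed.

Lemma lcoefN f a : lcoef (- f) a = - lcoef f a.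
Proof. by []. Qed.

Lemma lcoef0 a : lcoef (0 : laurent tau) a = 0.
Proof. exact: if_same. Qed.

Lemma lcoef1 a : lcoef (1 : laurent tau) a = (a == 0)%:R.
Proof. by rewrite /GRing.one /=; case: eqP. Qed.

Lemma lcoef_sum (I : Type) (r : seq I) (P : pred I) (F : I -> laurent tau) a :
  lcoef (\sum_(i <- r | P i) F i) a = \sum_(i <- r | P i) lcoef (F i) a.
Proof. by apply: (big_morph (fun F => lcoef F a)) => //; apply: lcoef0. Qed.

Lemma lcoefMn f i a : lcoef (f *+ i) a = lcoef f a *+ i.
Proof.
by elim: i => [|i IHi]; rewrite ?mulr0n ?lcoef0 // !mulrS -IHi lcoefD.
Qed.

Lemma lcoef_constM c f a : lcoef (lconst tau c * f) a = tau a c * lcoef f a.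
Proof.
rewrite /= (fsbigE [:: a]) //; last first.
  move=> l _; rewrite inE => la; rewrite ifF ?rmorph0 ?mul0r //.
  by apply/negbTE; rewrite subr_eq0 eq_sym.
by rewrite big_mkcond big_seq1 in_setT subrr eqxx.
Qed.

Lemma lconstM c d : lconst tau (c * d) = lconst tau c * lconst tau d.
Proof.
apply: laurentP => a; rewrite lcoef_constM /=.
by case: eqP => [->|_]; rewrite ?tw0 ?mulr0.
Qed.

Lemma lconst1 : lconst tau 1 = 1.
Proof. by []. Qed.

Definition window (B : nat) : seq int :=
  [seq i%:Z - B%:Z | i <- iota 0 B.*2.+1].

(** The sum defining a product runs over all integers with finite support. Any large enough window
    computes it, so several products can share one window and be compared term by term. *)
Lemma lcoefM_window f g a : exists N, forall B, (N <= B)%N ->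
  lcoef (f * g) a = \sum_(b <- window B) tau b (lcoef f (a - b)) * lcoef g b.
Proof.
have [Nf fN] := lcoef_bounded f; have [Ng gN] := lcoef_bounded g.
exists (`|Nf| + `|Ng| + `|a|)%N => B NB /=.
rewrite (fsbigE (window B)) //.
- by apply: eq_bigl => b; rewrite in_setT.
- by rewrite map_inj_uniq ?iota_uniq // => i j; lia.
move=> b _; have [b1|b1] := ltP b Ng; first by rewrite gN ?mulr0.
have [b2|b2] := ltP (a - b) Nf; first by rewrite fN ?rmorph0 ?mul0r.
move=> /mapP[]; exists `|(b + B%:Z)%R|%N; last by lia.
by rewrite mem_iota; lia.
Qed.

End LaurentTheory.

Lemma laurent_relP (R S : nzRingType) (tau : twist R) (sigma : twist S)
    (rel : R -> S -> Prop) :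
  ring_rel rel -> (forall b c d, rel c d -> rel (tau b c) (sigma b d)) ->
  ring_rel (@laurent_rel R S tau sigma rel).
Proof.
move=> relP reltw; split.
- by move=> a; rewrite !lcoef0; exact: (rel0 relP).
- by move=> a; rewrite !lcoef1; exact: (rel_nat relP).
- by move=> f g fg a; rewrite !lcoefN; exact: (relN relP).
- by move=> f g f' g' fg fg' a; rewrite !lcoefD; exact: (relD relP).
move=> f g f' g' fg fg' a.
have [N fN] := lcoefM_window f f' a; have [N' gN] := lcoefM_window g g' a.
rewrite (fN (maxn N N')) ?leq_maxl // (gN (maxn N N')) ?leq_maxr //.
by apply: (rel_sum relP) => b _; apply: (relM relP) => //; apply: reltw.
Qed.

(** * The logarithmic derivative of a determinant *)

(** The derivation t d/dt, which unlike d/dt keeps the degree in t. *)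
Definition euler (R : nzRingType) (F : tseries R) : tseries R :=
  TSeries (fun m => tcoef F m *+ m).

Section Euler.
Variable R : nzRingType.
Implicit Types F G : tseries R.

Lemma tcoef_euler F m : tcoef (euler F) m = tcoef F m *+ m.
Proof. by []. Qed.

Lemma eulerD F G : euler (F + G) = euler F + euler G.
Proof. by apply: tseriesP => m /=; rewrite mulrnDl. Qed.

Lemma euler0 : euler (0 : tseries R) = 0.
Proof. by apply: tseriesP => m; rewrite tcoef_euler tcoef0 mul0rn. Qed.

Lemma euler_sum (I : Type) (r : seq I) (P : pred I) (F : I -> tseries R) :
  euler (\sum_(i <- r | P i) F i) = \sum_(i <- r | P i) euler (F i).
Proof. exact: (big_morph _ eulerD euler0). Qed.

Lemma euler1 : euler (1 : tseries R) = 0.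
Proof. by apply: tseriesP => -[|m]; rewrite tcoef_euler tcoef0 tcoef1 ?mul0rn. Qed.

Lemma eulerM F G : euler (F * G) = euler F * G + F * euler G.
Proof.
apply: tseriesP => m; rewrite tcoefD /= -sumrMnl -big_split /=.
apply: eq_bigr => i _; rewrite mulrnAl mulrnAr -mulrnDr.
by congr (_ *+ _); have := ltn_ord i; lia.
Qed.

Lemma eulerMsign i F : euler ((-1) ^+ i * F) = (-1) ^+ i * euler F.
Proof.
have eulerN G : euler (- G) = - euler G.
  by apply: tseriesP => m /=; rewrite mulNrn.
elim: i => [|i IHi]; first by rewrite !expr0 !mul1r.
by rewrite !exprS !mulN1r !mulNr eulerN IHi.
Qed.

Lemma tcoefMsign i F m : tcoef ((-1) ^+ i * F) m = (-1) ^+ i * tcoef F m.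
Proof.
elim: i => [|i IHi]; first by rewrite !expr0 !mul1r.
by rewrite !exprS !mulN1r !mulNr tcoefN IHi.
Qed.

End Euler.

Section EulerDet.
Variable R : comNzRingType.
Implicit Types (F G S : tseries R).

Lemma euler_prod (I : finType) (F : I -> tseries R) :
  euler (\prod_i F i) = \sum_i \prod_j (if j == i then euler (F j) else F j).
Proof.
rewrite -!big_enum /=; under [RHS]eq_bigr do rewrite -big_enum /=.
elim: (enum I) (enum_uniq I) => [|i s IHs] /= => [_|/andP[iNs us]].
  by rewrite !big_nil euler1.
rewrite big_cons eulerM IHs // [RHS]big_cons [in X in _ = X + _]big_cons eqxx.
rewrite mulr_sumr; congr (_ * _ + _).
  by apply: eq_big_seq => j js; rewrite ifN //; apply: contraNneq iNs => <-.
apply: eq_big_seq => j js; rewrite big_cons ifN //.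
by apply: contraNneq iNs => ->.
Qed.

(** Jacobi's formula. The Leibniz rule differentiates one row at a time, and expanding det([B i])
    along its differentiated row i brings in the cofactors of A. *)
Lemma euler_det n (A : 'M[tseries R]_n) :
  euler (\det A) = \tr (map_mx (@euler R) A *m \adj A).
Proof.
pose B i := \matrix_(i', j) if i' == i then euler (A i' j) else A i' j.
transitivity (\sum_i \det (B i)).
  rewrite euler_sum exchange_big /=; apply: eq_bigr => s _.
  rewrite eulerMsign euler_prod mulr_sumr; apply: eq_bigr => i _.
  by congr (_ * _); apply: eq_bigr => j _; rewrite mxE.
apply: eq_bigr => i _; rewrite mxE (expand_det_row _ i).
apply: eq_bigr => j _; rewrite !mxE eqxx; congr (_ * (_ * \det _)).
by apply/matrixP => i' j'; rewrite !mxE eq_sym (negbTE (neq_lift _ _)).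
Qed.

Lemma map_euler_mulmx m n p (A : 'M[tseries R]_(m, n)) (B : 'M_(n, p)) :
  map_mx (@euler R) (A *m B)
  = map_mx (@euler R) A *m B + A *m map_mx (@euler R) B.
Proof.
apply/matrixP => i j; rewrite !mxE euler_sum -big_split /=.
by apply: eq_bigr => h _; rewrite eulerM !mxE.
Qed.

Lemma euler_trace n (A : 'M[tseries R]_n) :
  euler (\tr A) = \tr (map_mx (@euler R) A).
Proof. by rewrite euler_sum; apply: eq_bigr => i _; rewrite mxE. Qed.

(** N need not commute with its derivative; cyclicity of the trace replaces commutation. The extra
    factor N^b makes the induction on r go through. *)
Lemma trace_euler_exp n (N : 'M[tseries R]_n) b r :
  \tr (N ^+ b *m map_mx (@euler R) (N ^+ r.+1))
  = \tr (N ^+ (b + r) *m map_mx (@euler R) N) *+ r.+1.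
Proof.
elim: r b => [|r IHr] b; first by rewrite expr1 addn0.
rewrite exprS map_euler_mulmx mulmxDr mxtraceD mulmxA.
have -> : N ^+ b *m (N *m map_mx (@euler R) (N ^+ r.+1))
    = N ^+ b.+1 *m map_mx (@euler R) (N ^+ r.+1).
  by rewrite mulmxA [N ^+ b.+1]exprSr.
rewrite IHr mxtrace_mulC mulmxA [in RHS]mulrS addSnnS; congr (_ + _).
by rewrite addnC exprD.
Qed.

Lemma euler_trace_exp n (N : 'M[tseries R]_n) r :
  euler (\tr (N ^+ r.+1)) = \tr (N ^+ r *m map_mx (@euler R) N) *+ r.+1.
Proof.
have := trace_euler_exp N 0 r; rewrite add0n => <-.
by rewrite euler_trace -[N ^+ 0]/(1%:M) mul1mx.
Qed.

Lemma mxexpN n (N : 'M[tseries R]_n) r : (- N) ^+ r = (-1) ^+ r *: N ^+ r.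
Proof.
elim: r => [|r IHr]; first by rewrite !expr0 scale1r.
rewrite !exprS IHr mulN1r scaleNr mulNr; congr (- _).
exact/esym/scalemxAr.
Qed.

Lemma tcoef_mxexp_small n (N : 'M[tseries R]_n) r i j m :
  (forall i j, tcoef (N i j) 0 = 0) -> (m < r)%N -> tcoef ((N ^+ r) i j) m = 0.
Proof.
move=> N0; elim: r i j m => [//|r IHr] i j m mr.
rewrite exprS mxE tcoef_sum big1 // => h _; rewrite tcoefM big1 // => u _.
have [->|u0] := posnP u; first by rewrite N0 mul0r.
by rewrite IHr ?mulr0 //; have := ltn_ord u; lia.
Qed.

(* log det(1 + N) = tr log(1 + N), after applying t d/dt: the coefficients of
   det(1 + N) solve the linear recursion satisfied by those of
   exp(tr log(1 + N)). *)
Lemma det1p_rec n (N : 'M[tseries R]_n) (v : nat -> R) m :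
  (forall i j, tcoef (N i j) 0 = 0) ->
  (forall r, v r.+1 * r.+1%:R = 1) ->
  tcoef (\det (1%:M + N)) m *+ m
  = \sum_(i < m) tcoef (\det (1%:M + N)) i *
      ((\sum_(1 <= r < (m - i).+1)
         (-1) ^+ r.+1 * v r * tcoef (\tr (N ^+ r)) (m - i)) *+ (m - i)).
Proof.
move=> N0 vP; set d := \det _.
pose N' := map_mx (@euler R) N.
(* [g] is the geometric series for (1 + N)^(-1), cut at m terms. This is enough: the entries of N^m
   N' start at t^(m+1). *)
pose g := \sum_(r < m) (- N) ^+ r.
have smallS : forall i, (i < m)%N -> tcoef (\tr (g *m N')) (m - i)
  = (\sum_(1 <= r < (m - i).+1)
       (-1) ^+ r.+1 * v r * tcoef (\tr (N ^+ r)) (m - i)) *+ (m - i).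
  move=> i im; rewrite mulmx_suml raddf_sum /= tcoef_sum.
  rewrite -(big_mkord xpredT (fun r => tcoef (\tr ((- N) ^+ r *m N')) (m - i))).
  (* Powers with r >= m - i contribute nothing in degree m - i, because N' has no constant term
     either. *)
  rewrite (big_cat_nat (n := (m - i)%N)) ?leq_subr //= [X in _ + X]big1_seq.
    rewrite addr0 big_add1 /= -sumrMnl; apply: eq_big_nat => r _.
    rewrite -mulrnAr.
    have -> : tcoef (\tr (N ^+ r.+1)) (m - i) *+ (m - i)
        = tcoef (\tr (N ^+ r *m N')) (m - i) *+ r.+1.
      by have /(congr1 (fun F => tcoef F (m - i))) /= := euler_trace_exp N r;
         rewrite tcoefMn.
    rewrite exprS exprS !mulN1r opprK -mulr_natr -mulrA.
    rewrite [v _ * _]mulrC -!mulrA [_%:R * _]mulrC vP mulr1.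
    by rewrite mxexpN -scalemxAl mxtraceZ tcoefMsign.
  move=> r /andP[_]; rewrite mem_index_iota => /andP[ri _]; rewrite tcoef_sum big1 //.
  move=> a _; rewrite mxE tcoef_sum big1 // => b _; rewrite tcoefM big1 //.
  move=> u _; have [uE|um] := eqVneq (u : nat) (m - i)%N.
    by rewrite uE subnn !mxE /= mulr0n mulr0.
  rewrite tcoef_mxexp_small ?mul0r //.
    by move=> ? ?; rewrite mxE tcoefN N0 oppr0.
  by have := ltn_ord u; lia.
have dE : tcoef d m *+ m = tcoef (d * \tr (g *m N')) m.
  transitivity (tcoef (euler d) m); first by [].
  rewrite euler_det.
  have -> : map_mx (@euler R) (1%:M + N) = N'.
    apply/matrixP => a b; rewrite !mxE eulerD; case: (a == b).
      by rewrite mulr1n euler1 add0r.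
    by rewrite mulr0n euler0 add0r.
  rewrite mxtrace_mulC -mxtraceZ scalemxAl.
  (* The adjugate times 1 + N is d, while (1 + N) g = 1 - (-N)^m; the correction term is invisible
     at t^m. *)
  have -> : d *: g = \adj (1%:M + N) - \adj (1%:M + N) *m (- N) ^+ m.
    rewrite -mul_scalar_mx -mul_adj_mx -mulmxA.
    have -> : (1%:M + N) *m g = 1%:M - (- N) ^+ m.
      have /(subrXX_comm m) : GRing.comm 1 (- N) by apply/commr_sym/commr1.
      rewrite expr1n opprK => ->; congr (_ * _).
      by apply: eq_bigr => i _; rewrite expr1n mul1r.
    by rewrite mulmxBr mulmx1.
  rewrite mulmxBl mxtraceD tcoefD [X in tcoef _ _ + X](_ : _ = 0) ?addr0 //.
  have trN (Y : 'M[tseries R]_n) : \tr (- Y) = - \tr Y by exact: raddfN.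
  rewrite trN tcoefN -mulmxA /mxtrace tcoef_sum big1 ?oppr0 // => i _.
  rewrite mxE tcoef_sum big1 // => j _.
  rewrite tcoefM big1 // => u _.
  rewrite [(_ *m _) j i]mxE tcoef_sum big1 ?mulr0 // => h _.
  rewrite tcoefM big1 // => w _.
  have [um|um] := eqVneq (w : nat) m.
    have -> : (m - u - w = 0)%N by have := ltn_ord u; lia.
    by rewrite !mxE /= mulr0n mulr0.
  rewrite tcoef_mxexp_small ?mul0r //.
    by move=> ? ?; rewrite mxE tcoefN N0 oppr0.
  by have := ltn_ord u; have := ltn_ord w; lia.
rewrite dE tcoefM big_ord_recr /= subnn [X in _ * X](_ : _ = 0).
  by rewrite mulr0 addr0; apply: eq_bigr => i _; rewrite smallS.
rewrite /mxtrace tcoef_sum big1 // => i _; rewrite mxE tcoef_sum big1 // => j _.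
by rewrite tcoefM0 !mxE /= mulr0n mulr0.
Qed.

End EulerDet.

(** * The exponential series in characteristic zero *)

Lemma natr_neq0 (F : fieldType) r : [pchar F] =i pred0 -> r.+1%:R != 0 :> F.
Proof. by move=> /pcharf0P ->. Qed.

Lemma natr_mulVK (F : fieldType) (x : F) r : [pchar F] =i pred0 ->
  r.+1%:R^-1 * (x *+ r.+1) = x.
Proof. by move=> charF; rewrite -[x *+ _]mulr_natl mulKf // natr_neq0. Qed.

Lemma pchar_frac (F : fieldType) :
  [pchar F] =i pred0 -> [pchar {fraction {poly F}}] =i pred0.
Proof.
move=> charF; apply/pcharf0P => r; have /pcharf0P <- := charF.
by rewrite -(rmorph_nat (@FracField.tofrac {poly F})) tofrac_eq0 -polyC_natr polyC_eq0.
Qed.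

Section Texp.
Variable k : fieldType.
Hypothesis char0 : [pchar k] =i pred0.

Lemma pchar_qy : [pchar ratqy k] =i pred0.
Proof. exact/pchar_frac/pchar_frac. Qed.

Lemma texp0 (S : tseries (ratqy k)) : tcoef (texp S) 0 = 1.
Proof. by rewrite /= big_nat1 expr0 tcoef1 eqxx mulr1 invr1. Qed.

(** The differential equation of exp S for t d/dt, read coefficientwise. It has the same form as
    [det1p_rec], which is what makes the two sides of the theorem comparable. *)
Lemma texp_rec (S : tseries (ratqy k)) m : tcoef S 0 = 0 ->
  tcoef (texp S) m *+ m
  = \sum_(i < m) tcoef (texp S) i * (tcoef S (m - i) *+ (m - i)).
Proof.
move=> S0; have eulerX r : euler (S ^+ r.+1) = S ^+ r * euler S *+ r.+1.
  elim: r => [|r IHr]; first by rewrite expr1 expr0 mul1r.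
  by rewrite exprS eulerM IHr [in RHS]mulrS mulrnAr mulrA -exprS mulrC.
have fact0 r : (r`!)%:R != 0 :> ratqy k.
  by have := fact_gt0 r; case: (r`!) => // j _; apply: natr_neq0; apply: pchar_qy.
rewrite [tcoef (texp S) m]/= -sumrMnl big_nat_recl // expr0 tcoef1.
have -> : (0`!%:R)^-1 * (m == 0%N)%:R *+ m = 0 :> ratqy k.
  by case: m => [|m]; rewrite ?mulr0n // mulr0 mul0rn.
rewrite add0r.
transitivity (\sum_(0 <= r < m) (r`!%:R)^-1 * tcoef (S ^+ r * euler S) m).
  apply: eq_bigr => r _; rewrite -mulrnAr.
  have -> : tcoef (S ^+ r.+1) m *+ m = tcoef (S ^+ r * euler S) m * r.+1%:R.
    have /(congr1 (fun F => tcoef F m)) /= := eulerX r.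
    by rewrite tcoefMn => ->; rewrite mulr_natr.
  rewrite factS natrM invfM -!mulrA [r.+1%:R^-1 * _]mulrCA; congr (_ * _).
  by rewrite mulrCA mulVf ?mulr1 // natr_neq0 //; apply: pchar_qy.
transitivity (\sum_(0 <= r < m) \sum_(i < m)
    (r`!%:R)^-1 * tcoef (S ^+ r) i * (tcoef S (m - i) *+ (m - i))).
  apply: eq_bigr => r _; rewrite tcoefM big_ord_recr /= subnn mulr0n mulr0 addr0.
  by rewrite mulr_sumr; apply: eq_bigr => i _; rewrite mulrA.
rewrite exchange_big /=; apply: eq_bigr => i _; rewrite -mulr_suml; congr (_ * _).
(* In degree i, [texp] sums only over r <= i; the remaining powers S^r vanish there since S has no
   constant term. *)
rewrite (big_cat_nat (n := i.+1)) //= [X in _ + X]big1_seq ?addr0 //.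
move=> r /andP[_]; rewrite mem_index_iota => /andP[ri _].
by rewrite tcoef_exp_small ?mulr0.
Qed.

End Texp.

(** * The representation at a root of unity *)

Section Representation.
Variables (R : comNzRingType) (tau : twist R) (n : nat).
Implicit Types (f g : laurent tau) (F G : tseries (laurent tau)).

Fact lrho_subproof f (i j : 'I_n) : exists N : int, forall a : int, a < N ->
  (if (i%:Z == j%:Z + a %[mod n%:Z])%Z then tau j%:Z (lcoef f a) else 0) = 0.
Proof.
by have [N fN] := lcoef_bounded f; exists N => a /fN ->; rewrite rmorph0 if_same.
Qed.

Definition lrho f (i j : 'I_n) : laurent (notwist R) :=
  Laurent (notwist R) (lrho_subproof f i j).

Lemma lcoef_lrho f i j a : lcoef (lrho f i j) a =
  if (i%:Z == j%:Z + a %[mod n%:Z])%Z then tau j%:Z (lcoef f a) else 0.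
Proof. by []. Qed.

(** The matrix of [rho] for an arbitrary twist. It becomes multiplicative once [tau n] is the
    identity, as for f(y) -> f(z y) with z^n = 1. *)
Definition mrho F : 'M[tseries (laurent (notwist R))]_n :=
  \matrix_(i, j) TSeries (fun m => lrho (tcoef F m) i j).

Lemma lrhoD f g i j : lrho (f + g) i j = lrho f i j + lrho g i j.
Proof.
apply: laurentP => a; rewrite lcoefD /= rmorphD.
by case: ifP; rewrite ?addr0.
Qed.

Lemma lrho0 i j : lrho 0 i j = 0.
Proof.
by apply: laurentP => a; rewrite [RHS]lcoef0 /= if_same rmorph0 if_same.
Qed.

Lemma ord_eqmod (i j : 'I_n) : (i%:Z == j%:Z %[mod n%:Z])%Z = (i == j).
Proof.
by rewrite !modz_nat eqz_nat -val_eqE /= !modn_small.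
Qed.

Lemma lcoef_notwistM (f g : laurent (notwist R)) a : exists N, forall B,
  (N <= B)%N -> lcoef (f * g) a = \sum_(b <- window B) lcoef f (a - b) * lcoef g b.
Proof. exact: (@lcoefM_window R (notwist R) f g a). Qed.

Lemma mrhoD F G : mrho (F + G) = mrho F + mrho G.
Proof.
apply/matrixP => i j; rewrite !mxE; apply: tseriesP => m.
by rewrite tcoefD /= -lrhoD.
Qed.

Lemma mrho_const c :
  mrho (tconst (lconst tau c))
  = diag_mx (\row_j tconst (lconst (notwist R) (tau j%:Z c))).
Proof.
apply/matrixP => i j; rewrite !mxE; apply: tseriesP => m; apply: laurentP => a.
rewrite [LHS]/=; case: (eqVneq i j) => [->|ij].
  rewrite mulr1n /=; case: (m == 0%N) => /=; last by rewrite !if_same rmorph0 if_same.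
  case: (eqVneq a 0) => [->|a0]; first by rewrite addr0 eqxx.
  by rewrite rmorph0 if_same.
rewrite mulr0n tcoef0 lcoef0; case: (m == 0%N) => /=; last first.
  by rewrite !if_same rmorph0 if_same.
case: (eqVneq a 0) => [->|a0]; last by rewrite rmorph0 if_same.
by rewrite addr0 ord_eqmod (negbTE ij).
Qed.

Lemma lcoef_tr_mrho F m a :
  lcoef (tcoef (\tr (mrho F)) m) a
  = if (n%:Z %| a)%Z then \sum_(j < n) tau j%:Z (lcoef (tcoef F m) a) else 0.
Proof.
rewrite /mxtrace tcoef_sum lcoef_sum.
transitivity (\sum_(i < n)
    if (n%:Z %| a)%Z then tau i%:Z (lcoef (tcoef F m) a) else 0).
  apply: eq_bigr => i _; rewrite mxE /= -{1}[i%:Z]addr0 eqz_modDl.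
  by rewrite mod0z eq_sym (sameP eqP dvdz_mod0P).
by case: ifP => // _; rewrite big1.
Qed.

Hypothesis n_gt0 : (0 < n)%N.
Hypothesis tau_n : forall c, tau n%:Z c = c.

Lemma tau_eqmod (a b : int) c : (a = b %[mod n%:Z])%Z -> tau a c = tau b c.
Proof.
move=> ab; have tauM (u : nat) d : tau (u%:Z * n%:Z) d = d.
  elim: u => [|u IHu]; first by rewrite mul0r tw0.
  by rewrite -addn1 PoszD mulrDl mul1r twD tau_n.
have tauMz (u : int) d : tau (u * n%:Z) d = d.
  case: u => u; first exact: tauM.
  by rewrite -[d in LHS](tauM u.+1) -twD -mulrDl NegzE addNr mul0r tw0.
rewrite (divz_eq a n%:Z) [in RHS](divz_eq b n%:Z) ab.
by rewrite !twD !tauMz.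
Qed.

(** x^b sends v_j to a multiple of v_h with h = (j + b) mod n, so one intermediate index matters for
    each b. Taking the representative h turns [tau (j + b)] into [tau h], which is harmless because
    [tau n] is the identity. *)
Lemma lrhoM f g i j : lrho (f * g) i j = \sum_h lrho f i h * lrho g h j.
Proof.
apply: laurentP => a; rewrite lcoef_sum.
have [N fgN] := lcoefM_window f g a.
have /fin_all_exists[N' rN] :=
  fun h : 'I_n => lcoef_notwistM (lrho f i h) (lrho g h j) a.
pose B := (N + \sum_h N' h)%N.
transitivity (\sum_h \sum_(b <- window B)
    lcoef (lrho f i h) (a - b) * lcoef (lrho g h j) b); last first.
  apply: eq_bigr => h _; symmetry; apply: rN.
  by rewrite /B (bigD1 h) //=; lia.
rewrite lcoef_lrho (fgN B) ?leq_addr // exchange_big /=.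
transitivity (\sum_(b <- window B)
    if (i%:Z == j%:Z + a %[mod n%:Z])%Z
    then tau j%:Z (tau b (lcoef f (a - b)) * lcoef g b) else 0).
  by case: ifP => _; [rewrite rmorph_sum|rewrite big1].
apply: eq_bigr => b _.
have n0 : n%:Z != 0 by lia.
have h0P : (`|((j%:Z + b) %% n%:Z)%Z| < n)%N.
  by have := modz_ge0 (j%:Z + b) n0; have := ltz_pmod (j%:Z + b) (d := n%:Z); lia.
have h0E : (Ordinal h0P : nat)%:Z = ((j%:Z + b) %% n%:Z)%Z.
  by rewrite /= gez0_abs // modz_ge0.
rewrite (bigD1 (Ordinal h0P)) //= big1 ?addr0; last first.
  move=> h hh0; rewrite [X in _ * X]ifF ?mulr0 //; apply: contraNF hh0.
  by move=> /eqP hE; rewrite -ord_eqmod h0E modz_mod hE.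
rewrite -/(nat_of_ord (Ordinal h0P)) h0E modz_mod eqxx.
rewrite modzDml (_ : j%:Z + b + (a - b) = j%:Z + a); last by lia.
case: ifP => _; last by rewrite mul0r.
by rewrite rmorphM -twD (tau_eqmod _ (modz_mod _ _)).
Qed.

Lemma mrhoM F G : mrho (F * G) = mrho F * mrho G.
Proof.
apply/matrixP => i j; rewrite [RHS]mxE !mxE; apply: tseriesP => m.
rewrite tcoef_sum [LHS]/=.
have -> : lrho (tcoef (F * G) m) i j
    = \sum_(u < m.+1) lrho (tcoef F u * tcoef G (m - u)) i j.
  rewrite tcoefM; apply: (big_morph (fun f => lrho f i j)); last exact: lrho0.
  by move=> f g; apply: lrhoD.
under eq_bigr do rewrite lrhoM.
by rewrite exchange_big; apply: eq_bigr => h _; rewrite !mxE.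
Qed.

Lemma mrho1 : mrho 1 = 1%:M.
Proof.
have -> : 1 = tconst (lconst tau 1) by [].
rewrite mrho_const -diag_const_mx; congr diag_mx.
by apply/rowP => j; rewrite !mxE rmorph1.
Qed.

Lemma mrhoX F r : mrho (F ^+ r) = mrho F ^+ r.
Proof.
elim: r => [|r IHr]; first exact: mrho1.
by rewrite !exprS mrhoM IHr.
Qed.

Lemma det_mrho_constM c F :
  \det (mrho (tconst (lconst tau c) * F))
  = tconst (lconst (notwist R) (\prod_(j < n) tau j%:Z c)) * \det (mrho F).
Proof.
rewrite mrhoM mrho_const det_mulmx det_diag; congr (_ * _).
under eq_bigr do rewrite mxE.
rewrite (big_morph (fun d => tconst (lconst (notwist R) d))
  (id1 := 1) (op1 := *%R)) //.
by move=> d e; rewrite lconstM tconstM.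
Qed.

Lemma mrho1p F : mrho (1 + F) = 1%:M + mrho F.
Proof. by rewrite mrhoD mrho1. Qed.

End Representation.

(** * Supports in x and the part of ξ-degree zero *)

Lemma sum_neq0 (V : nmodType) (I : eqType) (r : seq I) (F : I -> V) :
  \sum_(i <- r) F i <> 0 -> exists2 i, i \in r & F i <> 0.
Proof.
move=> F0; apply: contrapT => nF; apply: F0; rewrite big_seq big1 // => i ir.
by apply: contrapT => Fi; apply: nF; exists i.
Qed.

Section Support.
Variables (R : nzRingType) (tau : twist R) (P : nat -> int -> Prop) (M : nat).
Implicit Types F G : tseries (laurent tau).
Hypothesis P0 : P 0%N 0.
Hypothesis PD : forall m m' a a', P m a -> P m' a' -> P (m + m')%N (a + a').

(** P is an additive condition on pairs (t-degree, x-degree). It will be the cone -mN <= a, or |a|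
    <= mN when Q is finite in x; as N depends on M, only m < M is constrained. *)
Definition supported F : Prop :=
  forall m a, (m < M)%N -> lcoef (tcoef F m) a <> 0 -> P m a.

Lemma supportedM F G : supported F -> supported G -> supported (F * G).
Proof.
move=> FP GP m a mM; rewrite tcoefM lcoef_sum => /sum_neq0[u _].
have [N /(_ N (leqnn _)) ->] := lcoefM_window (tcoef F u) (tcoef G (m - u)) a.
move=> /sum_neq0[b _] FG.
have -> : m = (u + (m - u))%N by have := ltn_ord u; lia.
have -> : a = a - b + b by rewrite subrK.
apply: PD; [apply: FP|apply: GP].
- by have := ltn_ord u; lia.
- by move=> F0; apply: FG; rewrite F0 rmorph0 mul0r.
- by lia.
- by move=> G0; apply: FG; rewrite G0 mulr0.
Qed.

Lemma supportedX F r : supported F -> supported (F ^+ r).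
Proof.
move=> FP; elim: r => [|r IHr]; last by rewrite exprS; apply: supportedM.
move=> m a _; rewrite expr0 tcoef1; case: m => [|m]; last by rewrite lcoef0.
by rewrite lcoef1; case: eqP => // ->.
Qed.

End Support.

(* Z is the set of exponents of xi, besides 0, that may occur: [n, oo) in general,
   and the empty set when Q is finite in x. *)
Definition leading (R : nzRingType) (Z : int -> Prop)
    (f : laurent (notwist R)) (c : R) : Prop :=
  (forall a, lcoef f a <> 0 -> a = 0 \/ Z a) /\ lcoef f 0 = c.

(** Exponents in Z are positive, so two of them never add up to 0: the coefficient of ξ^0 of a
    product is the product of those coefficients. *)
Lemma leadingP (R : nzRingType) (Z : int -> Prop) :
  (forall a, Z a -> 0 < a) -> (forall a b, Z a -> Z b -> Z (a + b)) ->
  ring_rel (@leading R Z).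
Proof.
move=> Zpos ZD; split.
- by split=> [a|]; rewrite lcoef0.
- by split=> [a|]; rewrite lcoef1 //; case: eqP => // ->; left.
- move=> f c [fZ fc]; split=> [a|]; rewrite lcoefN ?fc // => fa.
  by apply: fZ => f0; apply: fa; rewrite f0 oppr0.
- move=> f c g d [fZ fc] [gZ gd]; split=> [a|]; rewrite lcoefD ?fc ?gd // => fga.
  have [f0|/eqP] := eqVneq (lcoef f a) 0; last exact: fZ.
  by apply: gZ => g0; apply: fga; rewrite f0 g0 addr0.
move=> f c g d [fZ fc] [gZ gd]; split=> [a|].
  have [N /(_ N (leqnn _)) ->] := lcoefM_window f g a.
  move=> /sum_neq0[b _] /= fg.
  have /fZ fb : lcoef f (a - b) <> 0 by move=> f0; apply: fg; rewrite f0 mul0r.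
  have /gZ gb : lcoef g b <> 0 by move=> g0; apply: fg; rewrite g0 mulr0.
  case: gb fb => [->|Zb]; first by rewrite subr0.
  move=> [ab|Zab]; right; first by rewrite (_ : a = b) //; lia.
  by rewrite -(subrK b a); apply: ZD.
rewrite /= (fsbigE [:: 0]) //; last first.
  move=> b _; rewrite inE => b0; apply: contrapT => fg.
  have /fZ fb : lcoef f (0 - b) <> 0 by move=> f0; apply: fg; rewrite f0 mul0r.
  have /gZ gb : lcoef g b <> 0 by move=> g0; apply: fg; rewrite g0 mulr0.
  case: gb fb => [|/Zpos ? [|/Zpos]]; lia.
by rewrite big_mkcond big_seq1 in_setT subr0 fc gd.
Qed.

Section LeadingDet.
Variables (E : fieldType) (tau : twist E) (n : nat).
Hypothesis char0 : [pchar E] =i pred0.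
Hypothesis n_gt0 : (0 < n)%N.
Hypothesis tau_n : forall c, tau n%:Z c = c.
Variables (P : nat -> int -> Prop) (Z : int -> Prop) (M : nat).
Hypothesis P0 : P 0%N 0.
Hypothesis PD : forall m m' a a', P m a -> P m' a' -> P (m + m')%N (a + a').
Hypothesis Zpos : forall a, Z a -> 0 < a.
Hypothesis ZD : forall a b, Z a -> Z b -> Z (a + b).
Hypothesis PZ : forall m a, (m < M)%N -> P m a -> (n%:Z %| a)%Z -> a = 0 \/ Z a.
Variable G : tseries (laurent tau).
Hypothesis G0 : tcoef G 0 = 0.
Hypothesis GP : supported P M G.

Definition log1p_coef0 m : E :=
  \sum_(1 <= r < m.+1) (-1) ^+ r.+1 / r%:R * lcoef (tcoef (G ^+ r) m) 0.

Let s m := \sum_(j < n) tau j%:Z (log1p_coef0 m).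
Let det m := tcoef (\det (1%:M + mrho n G)) m.
Let N := mrho n G.
Let L m := \sum_(1 <= r < m.+1)
  (-1) ^+ r.+1 * lconst (notwist E) r%:R^-1 * tcoef (\tr (N ^+ r)) m.

Let leadP := leadingP E Zpos ZD.

(** Taking the constant term in t is compatible with ring operations, hence with det, and it turns 1
    + rho(G) into the identity matrix. *)
Lemma det1p_mrho0 : det 0 = 1.
Proof.
have relP : ring_rel (fun (F : tseries (laurent (notwist E))) c => tcoef F 0 = c).
  split; [exact: tcoef0|exact: tcoef1|by move=> F c <-|..].
    by move=> F c F' c' <- <-.
  by move=> F c F' c' <- <-; rewrite tcoefM0.
rewrite /det (rel_det (B := 1%:M) relP) ?det1 // => i j.
rewrite !mxE tcoefD tcoefMn tcoef1 -[RHS]addr0; congr (_ + _).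
by apply: laurentP => a; rewrite lcoef0 /= G0 lcoef0 rmorph0 if_same.
Qed.

(** The trace sees only x-exponents divisible by n, and [PZ] says that such an exponent is 0 or lies
    in Z. *)
Let leadL m : (m < M)%N -> leading Z (L m) (s m).
Proof.
move=> mM; have -> : s m = \sum_(1 <= r < m.+1) (-1) ^+ r.+1 * r%:R^-1 *
    \sum_(j < n) tau j%:Z (lcoef (tcoef (G ^+ r) m) 0).
  rewrite /s /log1p_coef0; under eq_bigr do rewrite rmorph_sum.
  rewrite exchange_big /=; apply: eq_bigr => r _; rewrite mulr_sumr.
  apply: eq_bigr => j _; rewrite !rmorphM fmorphV rmorph_nat.
  by rewrite rmorphXn rmorphN1.
apply: rel_sum => // r _; apply: (relM leadP).
  apply: (relM leadP); first exact: (rel_sign leadP).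
  split=> //= a; case: eqP => //; by left.
rewrite /N -mrhoX //; split=> [a|]; rewrite lcoef_tr_mrho ?dvdz0 //.
case: ifP => // na /sum_neq0[j _] Ga; apply: (PZ mM _ na).
apply: (supportedX P0 PD GP mM (r := r)) => Ga0.
by apply: Ga; rewrite Ga0 rmorph0.
Qed.

(** [det1p_rec] expresses m times the t^m coefficient by earlier ones and by [L], all with
    ξ-exponents in Z or 0. Its ξ^0 part is a recursion over the field E alone. At m = 0 it says
    nothing, and [det1p_mrho0] takes over. *)
Lemma leading_det1p_mrho m : (m < M)%N ->
  [/\ leading Z (det m) (lcoef (det m) 0) &
  lcoef (det m) 0 *+ m = \sum_(i < m) lcoef (det i) 0 * (s (m - i) *+ (m - i))].
Proof.
have [m0] := ubnP m; elim: m0 m => // m0 IH m /ltnSE mm0 mM.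
have : leading Z (det m *+ m)
    (\sum_(i < m) lcoef (det i) 0 * (s (m - i) *+ (m - i))).
  rewrite /det (det1p_rec (v := fun r => lconst (notwist E) r%:R^-1)).
  - apply: (rel_sum leadP) => i _; apply: (relM leadP).
      by apply: (proj1 (IH _ _ _)); have := ltn_ord i; lia.
    by apply/(relMn leadP)/leadL; lia.
  - move=> i j; rewrite mxE; apply: laurentP => a.
    by rewrite lcoef0 /= G0 lcoef0 rmorph0 if_same.
  move=> r; apply: laurentP => a; rewrite mulr_natr lcoefMn lcoef1 /=.
  case: eqP => _; last by rewrite mul0rn.
  by rewrite -[LHS]mulr_natr mulVf // natr_neq0.
case: m mm0 mM => [_ _ _|m mm0 mM [dZ d0]].
  split; last by rewrite mulr0n big_ord0.
  by rewrite det1p_mrho0 lcoef1; apply: (rel1 leadP).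
split; last by rewrite -d0 lcoefMn.
split=> // a da; apply: dZ; rewrite lcoefMn -mulr_natr => /eqP.
by rewrite mulf_eq0 (negbTE (natr_neq0 _ char0)) orbF => /eqP.
Qed.

End LeadingDet.

(** * Specialisation of q *)

Section Place.
Variables (A : comNzRingType) (F E : fieldType).
Variables (iota : {rmorphism A -> F}) (phi : {rmorphism A -> E}).
Hypothesis iota_inj : injective iota.

(* [phi] extended to the localisation of [A] at the complement of its kernel. *)
Definition place (f : F) (g : E) : Prop :=
  exists a b, [/\ phi b != 0, f = iota a / iota b & g = phi a / phi b].

Let iota_neq0 b : phi b != 0 -> iota b != 0.
Proof. by apply: contraNneq => /eqP; rewrite raddf_eq0 // => /eqP ->; rewrite rmorph0. Qed.

Lemma place_iota a : place (iota a) (phi a).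
Proof. by exists a, 1; rewrite !rmorph1 !divr1 oner_neq0. Qed.

Lemma place_inj f g g' : place f g -> place f g' -> g = g'.
Proof.
move=> [a [b [b0 -> ->]]] [c [d [d0 /eqP + ->]]].
rewrite eqr_div ?iota_neq0 // -!rmorphM => /eqP/iota_inj e.
by apply/eqP; rewrite eqr_div // -!rmorphM e.
Qed.

Lemma placeP : ring_rel place.
Proof.
split.
- by rewrite -(rmorph0 iota) -(rmorph0 phi); apply: place_iota.
- by rewrite -(rmorph1 iota) -(rmorph1 phi); apply: place_iota.
- move=> _ _ [a [b [b0 -> ->]]]; exists (- a), b.
  by rewrite !rmorphN !mulNr.
- move=> _ _ _ _ [a [b [b0 -> ->]]] [c [d [d0 -> ->]]].
  exists (a * d + c * b), (b * d); rewrite !rmorphM mulf_neq0 //.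
  by rewrite !addf_div ?iota_neq0 // !rmorphD !rmorphM.
move=> _ _ _ _ [a [b [b0 -> ->]]] [c [d [d0 -> ->]]].
by exists (a * c), (b * d); rewrite !mulf_div !rmorphM mulf_neq0.
Qed.

Lemma placeV f g : g != 0 -> place f g -> place f^-1 g^-1.
Proof.
move=> g0 [a [b [b0 fE gE]]]; exists b, a; rewrite fE gE !invf_div.
by split=> //; apply: contraNneq g0 => a0; rewrite gE a0 mul0r.
Qed.

Lemma place_neq0 f g : place f g -> g != 0 -> f != 0.
Proof.
move=> fg; apply: contraNneq => f0; rewrite f0 in fg.
by apply/eqP; apply: place_inj fg (rel0 placeP).
Qed.

Lemma place_expz f g (i : int) : g != 0 -> place f g -> place (f ^ i) (g ^ i).
Proof.
move=> g0 fg; case: i => i; first exact: (rel_exp placeP).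
by rewrite !NegzE -!invr_expz; apply: placeV; rewrite ?expf_neq0 //;
  apply: (rel_exp placeP).
Qed.

End Place.

(** * Dilations of the variable y, and specialisation of q *)

Section ScaleTheory.
Variable F : fieldType.
Implicit Types (c d : F) (f g : {fraction {poly F}}).

Definition fconst c : {fraction {poly F}} := (c%:P)%:F.

HB.instance Definition _ := GRing.RMorphism.copy fconst
  (@FracField.tofrac {poly F} \o polyC).

Lemma fconst_eq0 c : (fconst c == 0) = (c == 0).
Proof. by rewrite tofrac_eq0 polyC_eq0. Qed.

Lemma fracX_neq0 : 'X%:F != 0 :> {fraction {poly F}}.
Proof. by rewrite tofrac_eq0 polyX_eq0. Qed.

Lemma scale_frac_mul c d f : c != 0 -> d != 0 ->
  scale_frac (c * d) f = scale_frac c (scale_frac d f).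
Proof.
move=> c0 d0; have := frac_numden f; have := denom_ratioP (repr f).
move: (\n_(repr f)) (\d_(repr f)) => u v v0 ->.
rewrite (scale_fracE u (mulf_neq0 c0 d0) v0) (scale_fracE u d0 v0).
rewrite scale_fracE ?Defs.scale_poly_eq0 // /Defs.scale_poly.
have scaleM (p : {poly F}) : p \Po ((c * d) *: 'X) = (p \Po (d *: 'X)) \Po (c *: 'X).
  by rewrite -comp_polyA comp_polyZ comp_polyX scalerA [d * c]mulrC.
by rewrite (scaleM u) (scaleM v).
Qed.

Lemma scale_frac_id f : scale_frac 1 f = f.
Proof.
by rewrite [f]frac_numden scale_fracE ?oner_neq0 ?denom_ratioP //
  /Defs.scale_poly scale1r !comp_polyXr.
Qed.

Lemma scale_frac_const c d : c != 0 -> scale_frac c (fconst d) = fconst d.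
Proof. by move=> c0; rewrite scale_frac_poly // /Defs.scale_poly comp_polyC. Qed.

Lemma scale_fracX c : c != 0 -> scale_frac c 'X%:F = fconst c * 'X%:F.
Proof.
by move=> c0; rewrite scale_frac_poly // /Defs.scale_poly comp_polyX -mul_polyC tofracM.
Qed.

Variables (c : F) (c_neq0 : c != 0).

Fact scale_twist0 f : scale_frac (c ^ 0) f = f.
Proof. by rewrite expr0z scale_frac_id. Qed.

Fact scale_twistD (a b : int) f :
  scale_frac (c ^ (a + b)) f = scale_frac (c ^ a) (scale_frac (c ^ b) f).
Proof. by rewrite expfzDr // scale_frac_mul ?expfz_neq0. Qed.

(** The counterpart of [qtwist] after q has been replaced by c. *)
Definition scale_twist : twist {fraction {poly F}} :=
  @Twist _ (fun a => scale_morph (expfz_neq0 a c_neq0)) scale_twist0 scale_twistD.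

End ScaleTheory.

Section Specialisation.
Variables (k L : fieldType) (h : {rmorphism k -> L}) (z : L).
Hypothesis z_neq0 : z != 0.

Definition qeval : {poly k} -> L := horner_eval z \o map_poly h.
HB.instance Definition _ := GRing.RMorphism.copy qeval (horner_eval z \o map_poly h).

Definition qspec : ratq k -> L -> Prop := place (@FracField.tofrac {poly k}) qeval.

Definition yembed : {poly {poly k}} -> ratqy k :=
  @FracField.tofrac {poly ratq k} \o map_poly (@FracField.tofrac {poly k}).
HB.instance Definition _ := GRing.RMorphism.copy yembed
  (@FracField.tofrac {poly ratq k} \o map_poly (@FracField.tofrac {poly k})).

Definition yeval : {poly {poly k}} -> {fraction {poly L}} :=
  @FracField.tofrac {poly L} \o map_poly qeval.
HB.instance Definition _ := GRing.RMorphism.copy yeval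
  (@FracField.tofrac {poly L} \o map_poly qeval).

Lemma yembedM : {morph yembed : a b / a * b}. Proof. exact: rmorphM. Qed.
Lemma yembedD : {morph yembed : a b / a + b}. Proof. exact: rmorphD. Qed.
Lemma yembedN : {morph yembed : a / - a}. Proof. exact: rmorphN. Qed.
Lemma yembed1 : yembed 1 = 1. Proof. exact: rmorph1. Qed.
Lemma yembed0 : yembed 0 = 0. Proof. exact: rmorph0. Qed.
Lemma yembedXn i : {morph yembed : a / a ^+ i}. Proof. exact: rmorphXn. Qed.
Lemma yevalM : {morph yeval : a b / a * b}. Proof. exact: rmorphM. Qed.
Lemma yevalD : {morph yeval : a b / a + b}. Proof. exact: rmorphD. Qed.
Lemma yevalN : {morph yeval : a / - a}. Proof. exact: rmorphN. Qed.
Lemma yeval1 : yeval 1 = 1. Proof. exact: rmorph1. Qed.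
Lemma yeval0 : yeval 0 = 0. Proof. exact: rmorph0. Qed.
Lemma yevalXn i : {morph yeval : a / a ^+ i}. Proof. exact: rmorphXn. Qed.

Lemma yembedC c : yembed c%:P = fconst c%:F.
Proof. by rewrite /yembed /= map_polyC. Qed.

Lemma yevalC c : yeval c%:P = fconst (qeval c).
Proof. by rewrite /yeval /= map_polyC. Qed.

Lemma yembedX : yembed 'X = 'X%:F.
Proof. by rewrite /yembed /= map_polyX. Qed.

Lemma yembed_y : yembed 'X = yv k.
Proof. exact: yembedX. Qed.

Lemma qc_frac (a b : {poly k}) : qc (a%:F / b%:F) = yembed a%:P / yembed b%:P.
Proof. by rewrite !yembedC -fmorph_div. Qed.

Lemma yevalX : yeval 'X = 'X%:F.
Proof. by rewrite /yeval /= map_polyX. Qed.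

(* Specialisation at q = z. *)
Definition yspec : ratqy k -> {fraction {poly L}} -> Prop := place yembed yeval.

Lemma tofrac_inj (R : idomainType) : injective (@FracField.tofrac R).
Proof. by move=> x y /eqP; rewrite tofrac_eq => /eqP. Qed.

Lemma yembed_inj : injective yembed.
Proof.
move=> a b; rewrite /yembed /= => /tofrac_inj.
exact/(map_inj_poly (@tofrac_inj _))/tofrac0.
Qed.

Definition qspecP : ring_rel qspec := placeP qeval (@tofrac_inj _).
Definition yspecP : ring_rel yspec := placeP yeval yembed_inj.

Lemma yspec_inj f g g' : yspec f g -> yspec f g' -> g = g'.
Proof. exact: (place_inj yembed_inj). Qed.

Lemma yspecV f g : g != 0 -> yspec f g -> yspec f^-1 g^-1.
Proof. exact: placeV. Qed.

Lemma yspec_expz f g (i : int) : g != 0 -> yspec f g -> yspec (f ^ i) (g ^ i).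
Proof. exact: (place_expz yembed_inj). Qed.

Lemma yspec_const c d : qspec c d -> yspec (qc c) (fconst d).
Proof.
move=> [a [b [b0 -> ->]]]; exists a%:P, b%:P.
split; first by rewrite [X in X != 0]yevalC fconst_eq0.
  by rewrite [X in _ = X / _]yembedC [X in _ = _ / X]yembedC -fmorph_div.
by rewrite [X in _ = X / _]yevalC [X in _ = _ / X]yevalC -fmorph_div.
Qed.

Lemma qspec_q : qspec (qv k) z.
Proof.
have -> : z = qeval 'X by rewrite /qeval /= map_polyX /horner_eval hornerX.
exact: place_iota.
Qed.

Lemma qspec_qz (i : int) : qspec (qv k ^ i) (z ^ i).
Proof. exact: (place_expz (@tofrac_inj _) _ z_neq0 qspec_q). Qed.

Lemma yspec_y : yspec (yv k) 'X%:F.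
Proof.
rewrite -yevalX [yv k](esym yembedX).
exact: place_iota.
Qed.

Lemma yspec_natV r : [pchar k] =i pred0 -> yspec r%:R^-1 r%:R^-1.
Proof.
move=> char0; case: r => [|r]; first by rewrite !invr0; apply: (rel0 yspecP).
have r0 : (r.+1%:R : k) != 0 by apply: natr_neq0.
apply: yspecV; last exact: (rel_nat yspecP).
have -> : r.+1%:R = fconst (h r.+1%:R) :> {fraction {poly L}} by rewrite !rmorph_nat.
by rewrite fconst_eq0 fmorph_eq0.
Qed.

(** Both dilations are ring morphisms, so it suffices to look at constants and at y. Denominators
    stay nonzero after specialisation because a dilation is injective. *)
Lemma yspec_scale (a : int) f g :
  yspec f g -> yspec (scale_frac (qv k ^ a) f) (scale_frac (z ^ a) g).
Proof.
have q0 : qv k ^ a != 0 by rewrite expfz_neq0 ?qv_neq0.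
have z0 : z ^ a != 0 by rewrite expfz_neq0.
rewrite -[scale_frac _ f]/(scale_morph q0 f) -[scale_frac _ g]/(scale_morph z0 g).
have scaleE p : yspec (scale_morph q0 (yembed p)) (scale_morph z0 (yeval p)).
  elim/poly_ind: p => [|p c IHp]; first by rewrite yembed0 yeval0
    (rmorph0 (scale_morph q0)) (rmorph0 (scale_morph z0)); apply: (rel0 yspecP).
  rewrite yembedD yevalD yembedM yevalM.
  rewrite (rmorphD (scale_morph q0)) (rmorphD (scale_morph z0)).
  rewrite (rmorphM (scale_morph q0)) (rmorphM (scale_morph z0)).
  apply: (relD yspecP); first apply: (relM yspecP IHp).
    rewrite [X in scale_morph q0 X]yembedX [X in scale_morph z0 X]yevalX.
    rewrite [X in yspec X]scale_fracX // [X in yspec _ X]scale_fracX //.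
    apply: (relM yspecP); last exact: yspec_y.
    exact/yspec_const/qspec_qz.
  rewrite [X in scale_morph q0 X]yembedC [X in scale_morph z0 X]yevalC.
  rewrite [X in yspec X]scale_frac_const // [X in yspec _ X]scale_frac_const //.
  by apply: yspec_const; exact: place_iota.
move=> [a0 [b0 [b00 -> ->]]].
rewrite (fmorph_div (scale_morph q0)) (fmorph_div (scale_morph z0)).
apply: (relM yspecP); first exact: scaleE.
by apply: yspecV (scaleE b0); rewrite (fmorph_eq0 (scale_morph z0)).
Qed.

End Specialisation.

(** * The polynomials W_j(n, u) *)

Lemma sum_prim_root_expr (K : fieldType) n (w : K) a : n.-primitive_root w ->
  \sum_(i < n) w ^+ (i * a) = if (n %| a)%N then n%:R else 0.
Proof.
move=> wP; case: ifP => na.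
  rewrite (eq_bigr (fun=> 1)) ?sumr_const ?card_ord // => i _.
  by apply/eqP; rewrite -(prim_order_dvd wP) dvdn_mull.
have wa : w ^+ a - 1 != 0 by rewrite subr_eq0 -(prim_order_dvd wP) na.
have wan : (w ^+ a) ^+ n = 1.
  by rewrite -exprM mulnC exprM (prim_expr_order wP) expr1n.
apply: (mulfI wa); rewrite mulr0.
transitivity ((w ^+ a) ^+ n - 1); last by rewrite wan subrr.
by rewrite [RHS]subrX1; congr (_ * _); apply: eq_bigr => i _; rewrite -exprM mulnC.
Qed.

(* Since (u^n - 1) / (mu^i u - 1) = \sum_(l < n) (mu^i u)^l, summing the j-th
   powers over i keeps n times the monomials of exponent divisible by n. *)
Definition Wpoly (n j : nat) : {poly int} :=
  let S : {poly int} := (\sum_(a < n) 'X^a) ^+ j in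
  \sum_(a < size S | (n %| a)%N) S`_a *: 'X^(a %/ n).

(** Stated over any field with a primitive n-th root of unity: it serves over algC(u), where [W] is
    characterised, and over L(η), where [W] is evaluated. *)
Lemma sum_prim_root_inv (K : fieldType) n j (w x : K) :
  n.-primitive_root w -> x ^+ n != 1 ->
  \sum_(i < n) ((w ^+ i * x - 1) ^+ j)^-1
  = n%:R * (map_poly intr (Wpoly n j)).[x ^+ n] / (x ^+ n - 1) ^+ j.
Proof.
move=> wP xn1; set S : {poly int} := (\sum_(a < n) 'X^a) ^+ j.
have xn0 : x ^+ n - 1 != 0 by rewrite subr_eq0.
have termE (i : 'I_n) : ((w ^+ i * x - 1) ^+ j)^-1
    = (map_poly intr S).[w ^+ i * x] / (x ^+ n - 1) ^+ j.
  have wixE : (w ^+ i * x) ^+ n = x ^+ n.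
    by rewrite exprMn -exprM mulnC exprM (prim_expr_order wP) expr1n mul1r.
  have SE : (map_poly intr S).[w ^+ i * x] = (\sum_(a < n) (w ^+ i * x) ^+ a) ^+ j.
    rewrite rmorphXn rmorph_sum horner_exp horner_sum; congr (_ ^+ _).
    by apply: eq_bigr => a _; rewrite /= map_polyXn hornerXn.
  have := subrX1 (w ^+ i * x) n; rewrite wixE => e; rewrite SE e exprMn.
  have : (w ^+ i * x - 1) * (\sum_(a < n) (w ^+ i * x) ^+ a) != 0 by rewrite -e.
  rewrite mulf_eq0 negb_or => /andP[_ s0].
  by rewrite invfM mulrCA mulfV ?mulr1 // expf_neq0.
under eq_bigr do rewrite termE.
rewrite -mulr_suml; congr (_ / _).
transitivity (\sum_(i < n) \sum_(a < size S) (S`_a)%:~R * x ^+ a * w ^+ (i * a)).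
  apply: eq_bigr => i _; rewrite (@horner_coef_wide _ (size S)) ?size_poly //.
  by apply: eq_bigr => a _; rewrite coef_map exprMn -exprM mulrAC mulrA.
rewrite exchange_big /= /Wpoly -/S rmorph_sum horner_sum mulr_sumr.
rewrite [RHS]big_mkcond; apply: eq_bigr => a _.
rewrite -mulr_sumr sum_prim_root_expr //; case: ifP => na; last by rewrite mulr0.
rewrite /= map_polyZ hornerZ map_polyXn hornerXn -exprM mulnC divnK //.
by rewrite mulrC.
Qed.

Lemma tofrac_comp_int (F : fieldType) (p : {poly int}) (r : {poly F}) :
  (map_poly intr p \Po r)%:F = (map_poly intr p).[r%:F].
Proof.
elim/poly_ind: p => [|p c IHp]; first by rewrite !map_poly0 comp_poly0 horner0 tofrac0.
have mapE (R : nzRingType) :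
    map_poly intr (p * 'X + c%:P) = map_poly intr p * 'X + c%:~R%:P :> {poly R}.
  by rewrite rmorphD rmorphM /= map_polyX map_polyC.
rewrite !mapE comp_polyD comp_polyM comp_polyX comp_polyC tofracD tofracM IHp.
rewrite hornerD hornerM hornerX hornerC; congr (_ + _).
by rewrite -[LHS]/(fconst _) rmorph_int.
Qed.

(** After cancelling n and (u^n - 1)^j, the specification fixes W(u^n), and a polynomial is
    determined by its composite with u^n. *)
Lemma W_eq n j : (0 < n)%N -> W n j = Wpoly n j.
Proof.
move=> n0.
have WE mu : n.-primitive_root mu ->
    n%:R * ((map_poly intr (Wpoly n j) : {poly algC}) \Po 'X^n)%:F / ('X^n - 1)%:F ^+ j
    = \sum_(i < n) ((mu ^+ i *: 'X - 1 : {poly algC})%:F ^+ j)^-1.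
  move=> muP; rewrite tofrac_comp_int tofracD tofracN tofrac1 rmorphXn /=.
  rewrite -(sum_prim_root_inv j (w := fconst mu)).
  - apply: eq_bigr => i _; rewrite tofracD tofracN tofrac1 -mul_polyC tofracM.
    by rewrite -[(_%:P)%:F]/(fconst _) rmorphXn.
  - by rewrite fmorph_primitive_root.
  rewrite -rmorphXn /= -tofrac1 tofrac_eq -subr_eq0 -size_poly_eq0.
  by rewrite size_XnsubC.
have [mu muP] := C_prim_root_exists n0.
have Wx : W_spec n j (Wpoly n j) by exists mu; split; last exact: WE.
(* The root [nu] attached to the chosen [W n j] need not be [mu]; this does not matter, since [WE]
   holds for every primitive root. *)
have [nu [nuP]] : W_spec n j (W n j) by apply: (xgetI 0 Wx).
rewrite -(WE nu nuP).
have Xn0 : ('X^n - 1 : {poly algC})%:F ^+ j != 0.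
  by rewrite expf_neq0 // tofrac_eq0 -size_poly_eq0 size_XnsubC.
move=> /(mulIf (invr_neq0 Xn0)) /mulfI.
rewrite -[_%:R](rmorph_nat (@FracField.tofrac _)) tofrac_eq0.
rewrite -polyC_natr polyC_eq0 pnatr_eq0 -lt0n => /(_ n0) /tofrac_inj /eqP.
rewrite -subr_eq0 -comp_polyB comp_poly_eq0 ?size_polyXn // subr_eq0 => /eqP.
by apply: map_inj_poly => //; apply: intr_inj.
Qed.

(** * Reduction modulo Phi_n *)

Lemma irreducible_dvdp (k : fieldType) (u : {poly k}) :
  (1 < size u)%N -> exists2 p, irreducible_poly p & p %| u.
Proof.
move=> u1; pose P m := `[< exists2 p : {poly k}, (1 < size p)%N && (size p == m) & p %| u >].
have exP : exists m, P m.
  by exists (size u); apply/asboolP; exists u; rewrite ?u1 ?eqxx.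
case: (ex_minnP exP) => m /asboolP[p /andP[p1 /eqP pm] pu] minm.
have p0 : p != 0 by rewrite -size_poly_gt0 (ltn_trans _ p1).
exists p => //; split=> // q q1 qp; have q0 := dvdpN0 qp p0.
have {}q1 : (1 < size q)%N by rewrite ltn_neqAle eq_sym q1 size_poly_gt0.
rewrite -dvdp_size_eqp // eqn_leq dvdp_leq //= pm minm //.
by apply/asboolP; exists q; rewrite ?q1 ?eqxx // (dvdp_trans qp).
Qed.

Section CyclotomicField.
Variable k : fieldType.
Hypothesis char0 : [pchar k] =i pred0.

Lemma prod_Phi n : (0 < n)%N -> \prod_(d <- divisors n) Phi k d = 'X^n - 1.
Proof.
move=> n0; have /(congr1 (map_poly (intr : int -> k))) := prod_Cyclotomic n0.
by rewrite rmorph_prod rmorphB rmorph1 /= map_polyXn.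
Qed.

Lemma separable_Xn_sub1 n : (0 < n)%N -> separable_poly ('X^n - 1 : {poly k}).
Proof. by case: n => // n _; apply/separable_Xn_sub_1/natr_neq0. Qed.

Lemma Phi_dvdp n : (0 < n)%N -> Phi k n %| 'X^n - 1.
Proof.
move=> n0; rewrite -prod_Phi // (big_rem n) ?dvdp_mulr //=.
by rewrite -dvdn_divisors.
Qed.

Lemma separable_Phi n : (0 < n)%N -> separable_poly (Phi k n).
Proof. by move=> n0; apply: dvdp_separable (Phi_dvdp n0) (separable_Xn_sub1 n0). Qed.

Lemma coprimep_Xn_sub1_Phi i n : (0 < i < n)%N -> coprimep ('X^i - 1) (Phi k n).
Proof.
move=> /andP[i0 i_n]; have n0 : (0 < n)%N by apply: leq_trans i_n.
have in0 : (0 < i * n)%N by rewrite muln_gt0 i0.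
apply: (separable_coprime (separable_Xn_sub1 in0)).
rewrite -(prod_Phi in0) (bigID (fun d => d %| i)%N) /=; apply: dvdp_mul.
  rewrite -(prod_Phi i0) -[X in _ %| X]big_filter [X in _ %| X](perm_big (divisors i)) ?dvdpp //=.
  apply: uniq_perm; rewrite ?filter_uniq ?divisors_uniq // => d.
  rewrite mem_filter -!dvdn_divisors //.
  by case di: (d %| i)%N; rewrite //= dvdn_mulr.
rewrite (big_rem n) /=; last by rewrite -dvdn_divisors // dvdn_mull.
by rewrite gtnNdvd // dvdp_mulr.
Qed.

Lemma coprimep_X_Phi n : (0 < n)%N -> coprimep 'X (Phi k n).
Proof.
move=> n0; apply: coprimep_dvdl (Phi_dvdp n0) _.
rewrite coprimep_sym -[X in coprimep _ X]subr0 -polyC0 coprimep_XsubC /root.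
rewrite hornerD hornerN hornerXn hornerC expr0n gtn_eqF //= sub0r.
by rewrite oppr_eq0 oner_eq0.
Qed.

Lemma Phi_size n : (0 < n)%N -> (1 < size (Phi k n))%N.
Proof.
move=> n0; rewrite size_map_poly_id0; first by rewrite size_Cyclotomic ltnS totient_gt0.
by rewrite (monicP (Cyclotomic_monic n)) oner_neq0.
Qed.

(** If z had order m < n, it would be a common root of Phi_n and X^m - 1, which are coprime. *)
Lemma root_Phi_prim (L : fieldType) (h : {rmorphism k -> L}) n z :
  (0 < n)%N -> root (map_poly h (Phi k n)) z -> n.-primitive_root z.
Proof.
move=> n0 zP.
have zn : z ^+ n = 1.
  have : map_poly h (Phi k n) %| map_poly h ('X^n - 1) by rewrite dvdp_map Phi_dvdp.
  move=> /dvdpP[u /(congr1 (fun p => p.[z]))]; rewrite hornerM (rootP zP) mulr0.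
  rewrite rmorphB rmorph1 /= map_polyXn !hornerE => /eqP.
  by rewrite subr_eq0 => /eqP.
have [m mz mn] := prim_order_exists n0 zn.
have m0 : (0 < m)%N by apply: prim_order_gt0 mz.
have [mE|mn'] := eqVneq m n; first by rewrite -mE.
have mlt : (0 < m < n)%N by rewrite m0 ltn_neqAle mn' dvdn_leq.
have := coprimep_Xn_sub1_Phi mlt; rewrite -(coprimep_map h) coprimep_sym.
move=> /coprimep_root /(_ zP); rewrite rmorphB rmorph1 /= map_polyXn !hornerE.
by rewrite prim_expr_order // subrr eqxx.
Qed.

(** If Phi_n / gcd(Phi_n, a) were not constant, it would have an irreducible factor p. At a root of
    p in an extension a vanishes, so p divides the gcd as well, and p^2 divides the separable
    Phi_n. *)
Lemma Phi_dvdpP n (a : {poly k}) : (0 < n)%N ->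
  (forall (L : fieldType) (h : {rmorphism k -> L}) (z : L),
     root (map_poly h (Phi k n)) z -> root (map_poly h a) z) ->
  Phi k n %| a.
Proof.
move=> n0 H; set g := gcdp (Phi k n) a; pose u := Phi k n %/ g.
have Phi0 : Phi k n != 0 by rewrite -size_poly_gt0 (ltn_trans _ (Phi_size n0)).
have uE : u * g = Phi k n by rewrite divpK ?dvdp_gcdl.
have u0 : u != 0 by apply: contraNneq Phi0 => u0; rewrite -uE u0 mul0r.
have [u1|u1] := leqP (size u) 1.
  have : Phi k n %| g.
    have /size_poly1P[c c0 uc] : size u == 1 by rewrite eqn_leq u1 size_poly_gt0.
    by rewrite -uE uc mul_polyC (eqp_dvdl _ (eqp_scale _ c0)) dvdpp.
  by move=> /dvdp_trans; apply; apply: dvdp_gcdr.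
have [p pI pu] := irreducible_dvdp u1.
have [L _ [z pz _]] := irredp_FAdjoin pI.
have pPhi : p %| Phi k n by rewrite -uE dvdp_mulr.
have az : root (map_poly (in_alg L) a) z.
  by apply: H; have /dvdpP[v ->] := pPhi; rewrite rmorphM rootM pz orbT.
have pa : p %| a.
  have : ~~ coprimep p a.
    rewrite -(coprimep_map (in_alg L)); apply/negP => /coprimep_root/(_ pz).
    by rewrite (rootP az) eqxx.
  rewrite /coprimep => /(pI.2 _)/(_ (dvdp_gcdl _ _)) pg.
  by rewrite -(eqp_dvdl _ pg) dvdp_gcdr.
have : p ^+ 2 %| Phi k n by rewrite expr2 -uE dvdp_mul // dvdp_gcd pPhi.
by rewrite separable_nosquare ?separable_Phi // gtn_eqF // pI.
Qed.

Section Integral.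
Variable n : nat.
Hypothesis n_gt0 : (0 < n)%N.
Local Notation q := (qv k).
Local Notation y := (yv k).

Let den c d e : {poly {poly k}} := c%:P * 'X^d * ('X^n - 1) ^+ e.

Let yembed_den c d e : yembed (den c d e) = qc c%:F * y ^+ d * (y ^+ n - 1) ^+ e.
Proof.
by rewrite /den !yembedM !yembedXn yembedD yembedN yembedXn yembed1 yembedC yembedX.
Qed.

Let den_mul c d e c' d' e' :
  den c d e * den c' d' e' = den (c * c') (d + d') (e + e').
Proof. by rewrite /den polyCM !exprD; ring. Qed.

Let PhiN0 c : coprimep c (Phi k n) -> c != 0.
Proof.
move=> cP; apply/eqP => c0; move: cP; rewrite c0 coprime0p => /eqp_size.
by rewrite size_poly1 => e; have := Phi_size n_gt0; rewrite e.
Qed.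

Let den_neq0 c d e : coprimep c (Phi k n) -> den c d e != 0.
Proof.
move=> /PhiN0 c0; rewrite !mulf_neq0 ?polyC_eq0 ?expf_neq0 ?polyX_eq0 //.
by rewrite -size_poly_eq0 size_XnsubC.
Qed.

Let integralE f : Phi_integral n f <-> exists a c d e,
  coprimep c (Phi k n) /\ f = yembed a / yembed (den c d e).
Proof.
by split=> -[a [c [d [e [cP ->]]]]]; exists a, c, d, e;
  rewrite yembed_den.
Qed.

Let ye0 (b : {poly {poly k}}) : b != 0 -> yembed b != 0.
Proof.
by apply: contraNneq => b0; apply/eqP/yembed_inj; rewrite b0 yembed0.
Qed.

Let den1 d e : den 1 d e = 'X^d * ('X^n - 1) ^+ e.
Proof. by rewrite /den polyC1 mul1r. Qed.

Lemma integral_poly (a : {poly {poly k}}) : Phi_integral n (yembed a).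
Proof.
apply/integralE; exists a, 1, 0%N, 0%N; split; first exact: coprime1p.
by rewrite den1 !expr0 mulr1 yembed1 divr1.
Qed.

Lemma integralP :
  ring_rel (fun f _ : ratqy k => Phi_integral n f).
Proof.
split.
- by rewrite -(yembed0 k); apply: integral_poly.
- by rewrite -(yembed1 k); apply: integral_poly.
- move=> f _ [a [c [d [e [cP ->]]]]]; exists (- a), c, d, e; split=> //.
  by rewrite -mulNr -yembedN.
- move=> f _ g _ /integralE[a [c [d [e [cP ->]]]]] /integralE[a' [c' [d' [e' [cP' ->]]]]].
  apply/integralE; exists (a * den c' d' e' + a' * den c d e), (c * c'), (d + d')%N, (e + e')%N.
  rewrite coprimepMl cP cP'; split=> //.
  by rewrite addf_div ?ye0 ?den_neq0 // -den_mul yembedD !yembedM.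
move=> f _ g _ /integralE[a [c [d [e [cP ->]]]]] /integralE[a' [c' [d' [e' [cP' ->]]]]].
apply/integralE; exists (a * a'), (c * c'), (d + d')%N, (e + e')%N.
rewrite coprimepMl cP cP'; split=> //.
by rewrite mulf_div -den_mul !yembedM.
Qed.

Lemma integral_const p b : coprimep b (Phi k n) -> Phi_integral n (qc (p%:F / b%:F)).
Proof.
move=> bP; apply/integralE; exists p%:P, b, 0%N, 0%N; split=> //.
by rewrite /den !expr0 !mulr1 qc_frac.
Qed.

Lemma integral_yz (i : int) : Phi_integral n (y ^ i).
Proof.
case: i => i; first by rewrite -exprnP -yembed_y -yembedXn; apply: integral_poly.
apply/integralE; exists 1, 1, i.+1, 0%N; split; first exact: coprime1p.
by rewrite den1 expr0 mulr1 yembed1 yembedXn yembed_y div1r.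
Qed.

Lemma integral_ynV e : Phi_integral n ((y ^+ n - 1) ^+ e)^-1.
Proof.
apply/integralE; exists 1, 1, 0%N, e; split; first exact: coprime1p.
rewrite den1 expr0 mul1r yembed1 !yembedXn yembedD yembedN yembedXn yembed1 yembed_y.
by rewrite div1r.
Qed.

(** The denominator of f - g survives at every root of Phi_n, so equal specialisations kill every
    y-coefficient of the numerator there, and [Phi_dvdpP] applies to each coefficient. *)
Lemma Phi_congrP f g : Phi_integral n f -> Phi_integral n g ->
  (forall (L : fieldType) (h : {rmorphism k -> L}) (z : L),
     root (map_poly h (Phi k n)) z ->
     exists2 v, yspec h z f v & yspec h z g v) ->
  Phi_congr n f g.
Proof.
move=> fI gI H; split=> //.
have : Phi_integral n (f - g).
  by apply: (relD integralP) fI _ => //; apply: (relN integralP) gI.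
move=> /integralE[a [c [d [e [cP fgE]]]]].
have Phia i : Phi k n %| a`_i.
  apply: Phi_dvdpP => // L h z zP.
  have [v fv gv] := H L h z zP.
  have zprim := root_Phi_prim n_gt0 zP.
  have den0 : yeval h z (den c d e) != 0.
    have -> : yeval h z (den c d e)
        = fconst (qeval h z c) * 'X%:F ^+ d * ('X%:F ^+ n - 1) ^+ e.
      by rewrite /den !yevalM !yevalXn yevalD yevalN yevalXn yeval1 yevalC yevalX.
    rewrite !mulf_neq0 ?expf_neq0 ?fracX_neq0 //; last first.
      by rewrite -rmorphXn /= -tofrac1 -tofracB tofrac_eq0 -size_poly_eq0 size_XnsubC.
    rewrite fconst_eq0 /qeval /= /horner_eval.
    move: cP; rewrite coprimep_sym -(coprimep_map h) => /coprimep_root.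
    by apply.
  have : yspec h z (f - g) 0.
    by rewrite -(subrr v); apply: (relD (yspecP _ _)) fv _; apply: (relN (yspecP _ _)).
  rewrite fgE => /(yspec_inj (g' := yeval h z a / yeval h z (den c d e))).
  move=> /(_ _) e0; have {e0} /eqP : 0 = yeval h z a / yeval h z (den c d e).
    by apply: e0; exists a, (den c d e).
  rewrite eq_sym mulf_eq0 invr_eq0 (negbTE den0) orbF /yeval /= tofrac_eq0.
  move=> /eqP/(congr1 (fun p : {poly L} => p`_i)); rewrite coef_map coef0 => ai.
  by apply/rootP.
exists (yembed (map_poly (fun b => b %/ Phi k n) a) / yembed (den c d e)).
  by apply/integralE; exists (map_poly (fun b => b %/ Phi k n) a), c, d, e.
rewrite fgE mulrA; congr (_ / _).
rewrite -[qc _]/(fconst (Phi k n)%:F) -yembedC -yembedM; congr yembed.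
apply/polyP => i; rewrite coefCM coef_map_id0 ?div0p // mulrC divpK //.
Qed.

End Integral.
End CyclotomicField.

(** * Partial fractions *)

Section PartialFractions.
Variables (K F : fieldType) (cst : {rmorphism K -> F}) (q : K) (y : F).
Variable good : K -> Prop.
Hypotheses (q_neq0 : q != 0) (y_neq0 : y != 0).
Hypothesis pole_neq0 : forall i : int, cst (q ^ i) * y - 1 != 0.
Hypothesis q_expz_neq1 : forall i : int, i != 0 -> q ^ i != 1.
Hypothesis goodP : ring_rel (fun c _ : K => good c).
Hypothesis good_qz : forall i : int, good (q ^ i).
Hypothesis good_qV : forall i : int, i != 0 -> good (1 - q ^ i)^-1.

Local Notation u i := (cst (q ^ i) * y - 1).

Definition pfrac_sum (d : seq (int * K) * seq (int * nat * K)) : F :=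
  \sum_(z <- d.1) cst z.2 * y ^ z.1
  + \sum_(z <- d.2) cst z.2 / (cst (q ^ z.1.1) * y - 1) ^+ z.1.2.+1.

Definition good_pfrac (d : seq (int * K) * seq (int * nat * K)) : Prop :=
  {in d.1, forall z, good z.2} /\ {in d.2, forall z, good z.2}.

(** Coefficients are confined to [good], a subring containing q^i and (1 - q^i)^(-1): multiplying
    partial fractions creates no other constants. *)
Definition has_pfrac (f : F) : Prop := exists2 d, good_pfrac d & pfrac_sum d = f.

Lemma has_pfrac0 : has_pfrac 0.
Proof. by exists ([::], [::]); rewrite // /pfrac_sum !big_nil addr0. Qed.

Lemma has_pfracD f g : has_pfrac f -> has_pfrac g -> has_pfrac (f + g).
Proof.
move=> [d [d1 d2] <-] [e [e1 e2] <-]; exists (d.1 ++ e.1, d.2 ++ e.2).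
  by split=> z; rewrite mem_cat => /orP[]; auto.
by rewrite /pfrac_sum /= !big_cat /= addrACA.
Qed.

Lemma has_pfracZ c f : good c -> has_pfrac f -> has_pfrac (cst c * f).
Proof.
move=> cP [d [d1 d2] <-].
exists ([seq (z.1, c * z.2) | z <- d.1], [seq (z.1, c * z.2) | z <- d.2]).
  by split=> _ /mapP[z zd ->]; apply: (relM goodP) => //; auto.
rewrite /pfrac_sum /= !big_map mulrDr !mulr_sumr.
by congr (_ + _); apply: eq_bigr => z _; rewrite rmorphM !mulrA.
Qed.

Lemma has_pfracN f : has_pfrac f -> has_pfrac (- f).
Proof.
move=> fP; rewrite -mulN1r -(rmorphN1 cst); apply: has_pfracZ => //.
by apply: (relN goodP (b := 0)); apply: (rel1 goodP).
Qed.

Lemma has_pfracB f g : has_pfrac f -> has_pfrac g -> has_pfrac (f - g).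
Proof. by move=> fP /has_pfracN; apply: has_pfracD. Qed.

Lemma has_pfrac_yz (i : int) : has_pfrac (y ^ i).
Proof.
exists ([:: (i, 1)], [::]); last first.
  by rewrite /pfrac_sum big_seq1 big_nil rmorph1 mul1r addr0.
by split=> z; rewrite // inE => /eqP ->; apply: (rel1 goodP).
Qed.

Lemma has_pfrac_pole (i : int) j : has_pfrac (u i ^+ j.+1)^-1.
Proof.
exists ([::], [:: (i, j, 1)]); last first.
  by rewrite /pfrac_sum big_seq1 big_nil rmorph1 mul1r add0r.
by split=> z; rewrite // inE => /eqP ->; apply: (rel1 goodP).
Qed.

Lemma has_pfrac_lin (f g : F) :
  (forall i : int, has_pfrac (g * y ^ i)) ->
  (forall (i : int) j, has_pfrac (g / u i ^+ j.+1)) ->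
  has_pfrac f -> has_pfrac (g * f).
Proof.
move=> gy gu [d [d1 d2] <-]; rewrite mulrDr !mulr_sumr.
apply: has_pfracD; rewrite big_seq; apply: (big_ind has_pfrac) => //;
  try exact: has_pfrac0; try exact: has_pfracD; move=> z zd;
  rewrite mulrCA; apply: has_pfracZ => //; auto.
Qed.

Lemma has_pfrac_mul_y f : has_pfrac f -> has_pfrac (y * f).
Proof.
apply: has_pfrac_lin => [i|i j].
  by rewrite -{1}[y]expr1z -expfzDr //; apply: has_pfrac_yz.
(* From q^i y = u_i + 1. *)
have -> : y / u i ^+ j.+1
    = cst (q ^ (- i)) * ((u i ^+ j)^-1 + (u i ^+ j.+1)^-1).
  have qi0 : cst (q ^ i) != 0 by rewrite fmorph_eq0 expfz_neq0.
  have := pole_neq0 i; rewrite -invr_expz fmorphV; set a := cst _ => ui.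
  by rewrite exprS; field; rewrite ui qi0 expf_neq0.
apply: has_pfracZ => //; apply: has_pfracD; last exact: has_pfrac_pole.
by case: j => [|j]; rewrite ?expr0 ?invr1 -?(expr0z y);
  [apply: has_pfrac_yz|apply: has_pfrac_pole].
Qed.

Lemma has_pfrac_mul_yV f : has_pfrac f -> has_pfrac (y^-1 * f).
Proof.
apply: has_pfrac_lin => [i|i j].
  by rewrite -[y^-1]/(y ^ (- 1)) -expfzDr //; apply: has_pfrac_yz.
elim: j => [|j IHj].
  have -> : y^-1 / u i ^+ 1 = cst (q ^ i) * (u i ^+ 1)^-1 - y ^ (- 1).
    have := pole_neq0 i; rewrite -[y ^ (-1)]/(y^-1); set a := cst _ => ui.
    by field; rewrite ui y_neq0.
  apply: has_pfracB; last exact: has_pfrac_yz.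
  by apply: has_pfracZ => //; apply: has_pfrac_pole.
(* From 1 = q^i y - u_i, which trades a factor y^(-1) for a lower pole order. *)
have -> : y^-1 / u i ^+ j.+2
    = cst (q ^ i) * (u i ^+ j.+2)^-1 - y^-1 / u i ^+ j.+1.
  have := pole_neq0 i; set a := cst _ => ui.
  by rewrite !exprS; field; rewrite ui y_neq0 expf_neq0.
by apply: has_pfracB => //; apply: has_pfracZ => //; apply: has_pfrac_pole.
Qed.

Lemma has_pfrac_mul_pole (b : int) f : has_pfrac f -> has_pfrac ((u b)^-1 * f).
Proof.
apply: has_pfrac_lin => [i|i j].
  have yS f' : has_pfrac ((u b)^-1 * f') -> has_pfrac ((u b)^-1 * (y * f')).
    by move=> /has_pfrac_mul_y; rewrite mulrCA.
  have yP f' : has_pfrac ((u b)^-1 * f') -> has_pfrac ((u b)^-1 * (y^-1 * f')).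
    by move=> /has_pfrac_mul_yV; rewrite mulrCA.
  have base : has_pfrac ((u b)^-1 * 1).
    by rewrite mulr1 -[u b]expr1; apply: has_pfrac_pole.
  case: i => i; first by elim: i => [|i IHi] //; rewrite -exprnP exprS; apply: yS.
  rewrite NegzE -invr_expz -exprnP -exprVn; elim: i => [|i IHi].
    by rewrite expr1 -[y^-1]mulr1; apply: yP.
  by rewrite exprS; apply: yP.
have [<-|ib] := eqVneq i b.
  by rewrite -invfM -exprS; apply: has_pfrac_pole.
have bi0 : b - i != 0 by rewrite subr_eq0 eq_sym.
(* From q^(b-i) u_i - u_b = 1 - q^(b-i). Separating two distinct poles is what puts the polynomials
   q^i - 1 into the denominators. *)
have recE : forall m, (u b)^-1 / u i ^+ m.+1 = cst (1 - q ^ (b - i))^-1 *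
    (cst (q ^ (b - i)) * ((u b)^-1 / u i ^+ m) - (u i ^+ m.+1)^-1).
  move=> m; have q1 : 1 - cst (q ^ (b - i)) != 0.
    by rewrite -(rmorph1 cst) -rmorphB fmorph_eq0 subr_eq0 eq_sym q_expz_neq1.
  have := pole_neq0 b; have := pole_neq0 i.
  have -> : cst (q ^ b) = cst (q ^ (b - i)) * cst (q ^ i).
    by rewrite -rmorphM -expfzDr // subrK.
  rewrite fmorphV rmorphB rmorph1.
  move: q1; set c := cst (q ^ (b - i)); set a := cst (q ^ i) => q1 ui ub.
  by rewrite exprS; field; rewrite q1 ui ub expf_neq0.
elim: j => [|j IHj]; rewrite recE; apply: has_pfracZ; try exact: good_qV;
  apply: has_pfracB; try exact: has_pfrac_pole; apply: has_pfracZ => //.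
by rewrite expr0 divr1 -[u b]expr1; apply: has_pfrac_pole.
Qed.

Lemma has_pfracM f g : has_pfrac f -> has_pfrac g -> has_pfrac (f * g).
Proof.
move=> fP gP; rewrite mulrC; apply: has_pfrac_lin fP => [i|i j]; rewrite mulrC.
  case: i => i.
    elim: i => [|i IHi]; first by rewrite expr0z mul1r.
    by rewrite -exprnP exprS -mulrA; apply: has_pfrac_mul_y.
  rewrite NegzE -invr_expz -exprnP -exprVn.
  elim: i => [|i IHi]; first by rewrite expr1; apply: has_pfrac_mul_yV.
  by rewrite exprS -mulrA; apply: has_pfrac_mul_yV.
rewrite -exprVn; elim: j => [|j IHj]; first by rewrite expr1; apply: has_pfrac_mul_pole.
by rewrite exprS -mulrA; apply: has_pfrac_mul_pole.
Qed.

Lemma has_pfracP : ring_rel (fun f _ : F => has_pfrac f).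
Proof.
split; [exact: has_pfrac0|exact: (has_pfrac_yz 0)|..].
- by move=> f _ /has_pfracN.
- by move=> f _ g _; apply: has_pfracD.
- by move=> f _ g _; apply: has_pfracM.
Qed.

Lemma has_pfrac_const c : good c -> has_pfrac (cst c).
Proof. by move=> cP; rewrite -[cst c]mulr1 -(expr0z y); apply: has_pfracZ (has_pfrac_yz 0). Qed.

Lemma has_pfrac_scale (s : {rmorphism F -> F}) (l : int) f :
  (forall c, s (cst c) = cst c) -> s y = cst (q ^ l) * y ->
  has_pfrac f -> has_pfrac (s f).
Proof.
move=> sc sy [d [d1 d2] <-].
exists ([seq (z.1, z.2 * (q ^ l) ^ z.1) | z <- d.1],
        [seq ((z.1.1 + l, z.1.2), z.2) | z <- d.2]).
  split=> _ /mapP[z zd ->] /=; last exact: d2.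
  apply: (relM goodP (b := 0) (d := 0)); first exact: d1.
  by rewrite exprz_exp.
rewrite /pfrac_sum /= !big_map rmorphD !rmorph_sum.
congr (_ + _); apply: eq_bigr => z _.
  rewrite (rmorphM s) (fmorphXz s) (rmorphM cst) sc sy expfzMl.
  by rewrite (fmorphXz cst) mulrA.
rewrite rmorphM fmorphV rmorphXn rmorphB rmorph1 rmorphM !sc sy.
by rewrite /= expfzDr // rmorphM mulrA.
Qed.

End PartialFractions.

(** * Linear independence of partial fractions *)

Lemma sum_keys (T : eqType) (K F : nzRingType) (cst : {rmorphism K -> F})
    (s : seq (T * K)) (g : T -> F) :
  \sum_(z <- s) cst z.2 * g z.1
  = \sum_(t <- undup (map fst s)) cst (\sum_(z <- s | z.1 == t) z.2) * g t.
Proof.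
under [RHS]eq_bigr do rewrite rmorph_sum mulr_suml.
rewrite (exchange_big_dep xpredT) //= big_seq [RHS]big_seq.
apply: eq_bigr => z zs; under eq_bigl do rewrite eq_sym.
rewrite -[RHS]big_filter (filter_pred1_uniq (x := z.1)) ?undup_uniq ?big_seq1 //.
by rewrite mem_undup map_f.
Qed.

Section Independence.
Variables (K : fieldType) (q : K).
Hypothesis q_neq0 : q != 0.
Hypothesis q_expz_neq1 : forall i : int, i != 0 -> q ^ i != 1.
Local Notation F := {fraction {poly K}}.
Local Notation y := ('X%:F : F).
Local Notation u i := (fconst (q ^ i) * y - 1).

Let evp (s : K) : F -> K -> Prop := place (@FracField.tofrac {poly K}) (horner_eval s).
Let evpP s : ring_rel (evp s) := placeP (horner_eval s) (@tofrac_inj _).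

Let evp_frac s (p : {poly K}) : evp s p%:F p.[s].
Proof. exact: place_iota. Qed.

Let evp_u s i : evp s (u i) (q ^ i * s - 1).
Proof.
have -> : u i = ((q ^ i)%:P * 'X - 1)%:F by rewrite tofracB tofracM tofrac1.
have -> : q ^ i * s - 1 = ((q ^ i)%:P * 'X - 1).[s].
  by rewrite hornerD hornerN hornerM !hornerC hornerX.
exact: evp_frac.
Qed.

Lemma pole_frac_neq0 i : u i != 0.
Proof.
apply: place_neq0 (@tofrac_inj _) _ _ (evp_u 0 i) _.
by rewrite mulr0 sub0r oppr_eq0 oner_neq0.
Qed.

Variable d : seq (int * K) * seq (int * nat * K).
Hypothesis d0 : pfrac_sum (@fconst K) q y d = 0.

Let c1 i := \sum_(z <- d.1 | z.1 == i) z.2.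
Let c2 t := \sum_(z <- d.2 | z.1 == t) z.2.

Let c2_notin t : t \notin undup (map fst d.2) -> c2 t = 0.
Proof.
rewrite mem_undup => td; rewrite /c2 big_seq_cond big1 // => z /andP[zd /eqP zt].
by case/negP: td; rewrite -zt map_f.
Qed.

(* Multiplying by the j+1-st power of the pole and evaluating there isolates
   the coefficient of order j+1, once those of higher order vanish. *)
Let c2_step i j : (forall j', (j < j')%N -> c2 (i, j') = 0) -> c2 (i, j) = 0.
Proof.
move=> cj; pose s := (q ^ i)^-1; have qi0 : q ^ i != 0 by rewrite expfz_neq0.
have ui0 : evp s (u i) 0 by have := evp_u s i; rewrite mulfV // subrr.
have yr : evp s y s by rewrite -{2}[s]hornerX; apply: evp_frac.
have cst_r c : evp s (fconst c) c by rewrite -{2}[c](hornerC c s); apply: evp_frac.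
have y_r t : evp s (y ^ t) (s ^ t).
  by apply: (place_expz (@tofrac_inj _)) yr; rewrite invr_eq0.
have uX0 m : evp s (u i ^+ m.+1) 0.
  by rewrite -(mulr0 (0 ^+ m)) exprSr; apply: (relM (evpP s)) => //; apply: (rel_exp (evpP s)).
(* Only the key (i, j) survives at y = s: monomials and other poles are multiplied by 0, lower
   orders keep a positive power of u_i, and higher orders vanish by [cj]. *)
pose rhs := \sum_(t <- undup (map fst d.2)) if t == (i, j) then c2 t else 0.
have : evp s (pfrac_sum (@fconst K) q y d * u i ^+ j.+1) (0 + rhs).
  rewrite mulrDl; apply: (relD (evpP s)).
    rewrite mulr_suml [X in evp s _ X](_ : 0 = \sum_(z <- d.1) 0); last by rewrite big1_eq.
    apply: (rel_sum (evpP s)) => z _; rewrite -(mulr0 (z.2 * s ^ z.1)).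
    exact: (relM (evpP s) (relM (evpP s) (cst_r _) (y_r _)) (uX0 _)).
  rewrite (sum_keys (@fconst K) d.2 (fun t => (u t.1 ^+ t.2.+1)^-1)) mulr_suml.
  apply: (rel_sum (evpP s)) => -[i' j'] _; rewrite -/(c2 (i', j')) /=.
  have [->|ii'] := eqVneq i' i; last first.
    rewrite ifN; last by apply: contraNneq ii' => -[-> _].
    rewrite -(mulr0 (c2 (i', j') * ((q ^ i' * s - 1) ^+ j'.+1)^-1)).
    apply: (relM (evpP s)) (uX0 _); apply: (relM (evpP s)) (cst_r _) _.
    have qs : q ^ i' * s - 1 != 0.
      rewrite subr_eq0 /s invr_expz -expfzDr // q_expz_neq1 //.
      by rewrite subr_eq0.
    apply: placeV; first by rewrite expf_neq0.
    by apply: (rel_exp (evpP s)); apply: evp_u.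
  have ui : u i != 0 by apply: pole_frac_neq0.
  have [jj'|j'j|->] := ltngtP j j'.
  - rewrite (cj _ jj') rmorph0 !mul0r ifN; first exact: (rel0 (evpP s)).
    by apply/eqP => -[] jE; move: jj'; rewrite jE ltnn.
  - rewrite ifN; last by apply/eqP => -[] jE; move: j'j; rewrite jE ltnn.
    have -> : (j.+1 = (j - j'.+1).+1 + j'.+1)%N by lia.
    rewrite -mulrA exprD [X in _ * X]mulrC mulfK ?expf_neq0 //.
    rewrite -(mulr0 (c2 (i, j'))); exact: (relM (evpP s) (cst_r _) (uX0 _)).
  by rewrite eqxx mulfVK ?expf_neq0.
rewrite d0 mul0r add0r => /(place_inj (@tofrac_inj _) (rel0 (evpP s))) r0.
have [ijd|/c2_notin //] := boolP ((i, j) \in undup (map fst d.2)).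
have := esym r0; rewrite /rhs -big_mkcond -big_filter.
by rewrite (filter_pred1_uniq (x := (i, j))) ?undup_uniq ?big_seq1.
Qed.

Lemma pfrac_coef2_eq0 t : c2 t = 0.
Proof.
(* [J] bounds all pole orders in the list, so downward induction on j can start above it. *)
case: t => i j; pose J := (\sum_(z <- d.2) z.1.2)%N.
have big j' : (J < j')%N -> c2 (i, j') = 0.
  move=> Jj; apply: c2_notin; rewrite mem_undup; apply/mapP => -[z zd zE].
  have : (z.1.2 <= J)%N by rewrite /J (big_rem z) //= leq_addr.
  by rewrite -zE /= leqNgt Jj.
have [m] := ubnP (J - j)%N; elim: m j => // m IHm j jm.
apply: c2_step => j' jj'; have [Jj|j'J] := ltnP J j'; first exact: big.
by apply: IHm; lia.
Qed.

Lemma pfrac_coef1_eq0 i : c1 i = 0.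
Proof.
have : \sum_(z <- d.1) fconst z.2 * y ^ z.1 = 0.
  move: d0; rewrite /pfrac_sum.
  rewrite (sum_keys (@fconst K) d.2 (fun t => (u t.1 ^+ t.2.+1)^-1)).
  rewrite [X in _ + X]big1 ?addr0 // => t _.
  by rewrite -/(c2 t) pfrac_coef2_eq0 rmorph0 mul0r.
(* Multiplying by y^N clears negative powers. [N] also bounds |i|, so the absolute values taken
   below do not merge distinct exponents. *)
pose N := (\sum_(z <- d.1) `|z.1| + `|i|)%N.
move=> /(congr1 (fun f => f * y ^ N)); rewrite mul0r mulr_suml.
have dN z : z \in d.1 -> (`|z.1| <= N)%N.
  by move=> zd; rewrite /N (big_rem z) //= -addnA leq_addr.
rewrite (eq_big_seq (fun z : int * K => (z.2 *: 'X^`|(z.1 + N%:Z)%R|%N)%:F)); last first.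
  move=> z /dN zN; rewrite -mulrA -expfzDr ?fracX_neq0 //.
  rewrite -{1}[z.1 + N%:Z]gez0_abs; last by lia.
  by rewrite -mul_polyC tofracM -exprnP tofracXn.
rewrite -(rmorph_sum (@FracField.tofrac {poly K})) -tofrac0 => /tofrac_inj.
move=> /(congr1 (fun p : {poly K} => p`_`|(i + N%:Z)%R|%N)); rewrite coef0 coef_sum => e.
rewrite -[RHS]e /c1 big_mkcond; apply: eq_big_seq => z /dN zN.
rewrite coefZ coefXn; case: eqVneq => [->|zi]; first by rewrite eqxx mulr1.
rewrite (_ : (_ == _) = false) ?mulr0 //.
apply/negbTE/eqP => iz; case/eqP: zi; have iN : (`|i| <= N)%N by rewrite /N leq_addl.
by move: zN iz iN; move: (z.1) (N) => a b; lia.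
Qed.

Lemma pfrac_transfer0 (g1 : int -> F) (g2 : int * nat -> F) :
  \sum_(z <- d.1) fconst z.2 * g1 z.1 + \sum_(z <- d.2) fconst z.2 * g2 z.1 = 0.
Proof.
rewrite (sum_keys (@fconst K) d.1 g1) (sum_keys (@fconst K) d.2 g2).
rewrite !big1 ?addr0 // => t _.
  by rewrite -/(c2 t) pfrac_coef2_eq0 rmorph0 mul0r.
by rewrite -/(c1 t) pfrac_coef1_eq0 rmorph0 mul0r.
Qed.

End Independence.

(** The linear map with prescribed values [g1], [g2] on monomials and poles; [pfrac_val] and
    [pfrac_R] are both of this form. *)
Definition pfrac_eval (K : fieldType) (g1 : int -> {fraction {poly K}})
    (g2 : int * nat -> {fraction {poly K}})
    (d : seq (int * K) * seq (int * nat * K)) : {fraction {poly K}} :=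
  \sum_(z <- d.1) fconst z.2 * g1 z.1 + \sum_(z <- d.2) fconst z.2 * g2 z.1.

Lemma pfrac_evalB (K : fieldType) g1 g2 (d e : seq (int * K) * seq (int * nat * K)) :
  pfrac_eval g1 g2 (d.1 ++ [seq (z.1, - z.2) | z <- e.1],
                    d.2 ++ [seq (z.1, - z.2) | z <- e.2])
  = pfrac_eval g1 g2 d - pfrac_eval g1 g2 e.
Proof.
rewrite /pfrac_eval /= !big_cat !big_map opprD addrACA /= -!sumrN.
congr (_ + _ + (_ + _)); apply: eq_bigr => z _;
  by rewrite (rmorphN (@fconst K)) mulNr.
Qed.

(* Partial fractions are linearly independent, so that any choice of values
   for them extends to a well-defined linear map. *)
Lemma pfrac_transfer (K : fieldType) (q : K) (g1 : int -> {fraction {poly K}})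
    (g2 : int * nat -> {fraction {poly K}})
    (d e : seq (int * K) * seq (int * nat * K)) :
  q != 0 -> (forall i : int, i != 0 -> q ^ i != 1) ->
  pfrac_sum (@fconst K) q 'X%:F d = pfrac_sum (@fconst K) q 'X%:F e ->
  pfrac_eval g1 g2 d = pfrac_eval g1 g2 e.
Proof.
move=> q0 q1 de; apply/eqP; rewrite -subr_eq0 -pfrac_evalB.
apply/eqP/(pfrac_transfer0 q0 q1).
have := pfrac_evalB (fun i => 'X%:F ^ i)
  (fun t => ((fconst (q ^ t.1) * 'X%:F - 1) ^+ t.2.+1)^-1) d e.
rewrite -[pfrac_eval _ _ d]/(pfrac_sum (@fconst K) q 'X%:F d) de.
rewrite -[pfrac_eval _ _ e]/(pfrac_sum (@fconst K) q 'X%:F e) subrr.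
by [].
Qed.

(** * The operator R_eps *)

Lemma rel_horner_int (R S : comNzRingType) (rel : R -> S -> Prop) (p : {poly int}) a b :
  ring_rel rel -> rel a b -> rel (map_poly intr p).[a] (map_poly intr p).[b].
Proof.
move=> relP ab; elim/poly_ind: p => [|p c IHp].
  by rewrite !map_poly0 !horner0; apply: (rel0 relP).
have mapE (T : nzRingType) :
    map_poly intr (p * 'X + c%:P) = map_poly intr p * 'X + c%:~R%:P :> {poly T}.
  by rewrite rmorphD rmorphM /= map_polyX map_polyC.
rewrite !mapE !hornerD !hornerM !hornerX !hornerC.
apply: (relD relP); first exact: (relM relP).
case: c {mapE} => c; first exact: (rel_nat relP).
by rewrite NegzE !rmorphN; apply/(relN relP)/(rel_nat relP).
Qed.

Lemma prim_root_neq0 (K : fieldType) n (w : K) : n.-primitive_root w -> w != 0.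
Proof.
move=> wP; apply/eqP => w0; have := prim_expr_order wP.
by rewrite w0 expr0n gtn_eqF ?(prim_order_gt0 wP) // => /esym/eqP; rewrite oner_eq0.
Qed.

(** The bound on |i| excludes nonzero multiples of n, where the sum is n although R_{n,eps} sends
    that power to 0. *)
Lemma sum_prim_root_expz (K : fieldType) n (w : K) (i : int) :
  n.-primitive_root w -> (`|i| < n)%N ->
  \sum_(j < n) (w ^ j%:Z) ^ i = if i == 0 then n%:R else 0.
Proof.
move=> wP; case: i => a an.
  under eq_bigr do rewrite -!exprnP -exprM.
  rewrite sum_prim_root_expr //; case: a an => [|a] an; first by rewrite dvdn0.
  by rewrite gtnNdvd.
have a0 : (0 < n - a.+1)%N by rewrite subn_gt0.
(* The exponent -(a+1) is replaced by n - (a+1), which is positive and below n. *)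
transitivity (\sum_(j < n) w ^+ (j * (n - a.+1))).
  apply: eq_bigr => j _; have w0 : w != 0 by rewrite (prim_root_neq0 wP).
  rewrite NegzE -exprnP -!exprnN; apply: (mulIf (expf_neq0 a.+1 (expf_neq0 j w0))).
  rewrite mulVf ?expf_neq0 // -exprM -exprD -mulnDr subnK; last exact: ltnW.
  by rewrite mulnC exprM (prim_expr_order wP) expr1n.
by rewrite sum_prim_root_expr // gtnNdvd //; lia.
Qed.

Lemma localization_rel (A : comNzRingType) (F : fieldType)
    (iota : {rmorphism A -> F}) (S : A -> Prop) :
  S 1 -> (forall a b, S a -> S b -> S (a * b)) -> (forall a, S a -> iota a != 0) ->
  ring_rel (fun f _ : F => exists a b, S b /\ f = iota a / iota b).
Proof.
move=> S1 SM S0; split.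
- by exists 0, 1; rewrite rmorph0 mul0r.
- by exists 1, 1; rewrite rmorph1 divr1.
- move=> f _ [a [b [bS ->]]]; exists (- a), b; split=> //.
  by rewrite rmorphN mulNr.
- move=> f _ g _ [a [b [bS ->]]] [c [d [dS ->]]].
  exists (a * d + c * b), (b * d); split; first exact: SM.
  by rewrite addf_div ?S0 // rmorphD !rmorphM.
move=> f _ g _ [a [b [bS ->]]] [c [d [dS ->]]].
by exists (a * c), (b * d); split; [apply: SM|rewrite mulf_div !rmorphM].
Qed.

Section REps.
Variable k : fieldType.
Hypothesis char0 : [pchar k] =i pred0.
Local Notation q := (qv k).
Local Notation y := (yv k).

Lemma qv_expz_neq1 (i : int) : i != 0 -> q ^ i != 1.
Proof.
have qS (a : nat) : q ^+ a.+1 != 1.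
  by rewrite -tofracXn -tofrac1 tofrac_eq -subr_eq0 -size_poly_eq0 size_XnsubC.
case: i => [[|a]|a] // _; first by rewrite -exprnP.
by rewrite NegzE -invr_expz invr_eq1 -exprnP.
Qed.

Definition good_den (b : {poly k}) : Prop :=
  exists C : nat, forall n, (C < n)%N -> coprimep b (Phi k n).

(** The subring used as [good]. The threshold of [good_den] depends on the denominator, since q^i -
    1 is coprime to Phi_n only beyond some n. *)
Definition good_coef (c : ratq k) : Prop :=
  exists p b : {poly k}, good_den b /\ c = p%:F / b%:F.

Lemma good_den1 : good_den 1.
Proof. by exists 0%N => n _; apply: coprime1p. Qed.

Lemma good_coef_poly (p : {poly k}) : good_coef p%:F.
Proof. by exists p, 1; split; [exact: good_den1|rewrite tofrac1 divr1]. Qed.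

Lemma good_coefP : ring_rel (fun c _ : ratq k => good_coef c).
Proof.
apply: (localization_rel (iota := @FracField.tofrac {poly k}) good_den1).
  move=> a b [Ca aP] [Cb bP]; exists (maxn Ca Cb) => n.
  by rewrite gtn_max => /andP[Can Cbn]; rewrite coprimepMl aP ?bP.
move=> b [C bP]; rewrite /= tofrac_eq0; apply/eqP => b0.
have := bP C.+1 (ltnSn _); rewrite b0 coprime0p => /eqp_size.
by rewrite size_poly1 => e; have := Phi_size k (ltn0Sn C); rewrite e.
Qed.

Lemma good_coef_qz (i : int) : good_coef (q ^ i).
Proof.
case: i => i; first by rewrite -exprnP -tofracXn; apply: good_coef_poly.
exists 1, 'X^(i.+1); split; last by rewrite tofrac1 div1r tofracXn NegzE -invr_expz.
by exists 0%N => n n0; apply/coprimep_expl/coprimep_X_Phi.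
Qed.

Lemma good_coef_qV (i : int) : i != 0 -> good_coef (1 - q ^ i)^-1.
Proof.
have posP (a : nat) : (0 < a)%N -> good_coef (q ^+ a - 1)^-1.
  move=> a0; exists 1, ('X^a - 1); split.
    by exists a => n an; apply: coprimep_Xn_sub1_Phi; rewrite ?a0.
  by rewrite tofrac1 div1r tofracB tofracXn tofrac1.
case: i => [[|a]|a] // _.
  rewrite -exprnP -opprB invrN; apply: (relN good_coefP (b := 0)).
  exact: posP.
have qa0 : q ^+ a.+1 != 0 by rewrite expf_neq0 ?qv_neq0.
rewrite NegzE -invr_expz -exprnP.
have -> : (1 - (q ^+ a.+1)^-1)^-1 = q ^+ a.+1 * (q ^+ a.+1 - 1)^-1.
  by rewrite -[X in _ = X * _]invrK -invfM mulrBr mulVf // mulr1.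
apply: (relM good_coefP (b := 0) (d := 0)); last exact: posP.
by rewrite -tofracXn; apply: good_coef_poly.
Qed.

Definition has_good_pfrac : ratqy k -> Prop := has_pfrac (@fconst (ratq k)) q y good_coef.

Let yX0 := @fracX_neq0 (ratq k).
Let poleX0 := pole_frac_neq0 q.

Definition has_good_pfrac_rel : ring_rel (fun f _ : ratqy k => has_good_pfrac f) :=
  has_pfracP (qv_neq0 k) yX0 poleX0 qv_expz_neq1 good_coefP good_coef_qz good_coef_qV.

Lemma has_good_pfrac_const c : good_coef c -> has_good_pfrac (fconst c).
Proof. by move=> cP; apply: has_pfrac_const cP; apply: good_coefP. Qed.

Lemma has_good_pfrac_natV r : has_good_pfrac r%:R^-1.
Proof.
have -> : r%:R^-1 = fconst (r%:R^-1)%:P%:F :> ratqy k.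
  by rewrite -[(_%:P)%:F]/(fconst _) !fmorphV !rmorph_nat.
exact/has_good_pfrac_const/good_coef_poly.
Qed.

Lemma has_good_pfrac_yz (i : int) : has_good_pfrac (y ^ i).
Proof. exact (has_pfrac_yz (@fconst (ratq k)) q y good_coefP i). Qed.

Definition laurent_eval N (p : {poly ratq k}) : ratqy k :=
  (\sum_(i < size p) fconst p`_i * y ^ i%:Z) * y ^ (- N%:Z).

Lemma laurent_qyE N (f : ratqy k) : is_laurent_qy N f ->
  exists2 p : {poly ratq k}, forall i, is_laurent_q p`_i & f = laurent_eval N p.
Proof.
move=> [p [_ pP ->]]; exists p => //.
rewrite /laurent_eval -exprnN; congr (_ * _); rewrite -[p in LHS]coefK poly_def.
rewrite (rmorph_sum (@FracField.tofrac _)); apply: eq_bigr => i _.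
by rewrite /= -mul_polyC tofracM tofracXn.
Qed.

Lemma has_good_pfrac_laurent N f : is_laurent_qy N f -> has_good_pfrac f.
Proof.
case/laurent_qyE=> p pP ->; rewrite /laurent_eval.
apply: (relM has_good_pfrac_rel (b := 0) (d := 0)); last exact: has_good_pfrac_yz.
apply: (@rel_sum _ _ _ has_good_pfrac_rel _ _ _ _ (fun=> 0)) => i _.
apply: (relM has_good_pfrac_rel (b := 0) (d := 0)); last exact: has_good_pfrac_yz.
apply: has_good_pfrac_const.
have [a [e ->]] := pP i.
apply: (relM good_coefP (b := 0) (d := 0)); first exact: good_coef_poly.
by have := good_coef_qz (- e%:Z); rewrite -exprnN.
Qed.

Lemma has_good_pfrac_scale (a : int) f : has_good_pfrac f -> has_good_pfrac (scale_frac (q ^ a) f).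
Proof.
have qa0 : q ^ a != 0 by rewrite expfz_neq0 ?qv_neq0.
apply: (@has_pfrac_scale _ _ _ _ _ _ (qv_neq0 k) good_coefP good_coef_qz
  (scale_morph qa0) a) => [c|]; first exact: scale_frac_const.
exact: scale_fracX.
Qed.

Lemma has_good_pfrac_poleV (a : int) : has_good_pfrac (y - qc (q ^ a))^-1.
Proof.
have pole0 := poleX0 (- a).
have qa0 : fconst (q ^ (- a)) != 0 by rewrite fconst_eq0 expfz_neq0 ?qv_neq0.
have -> : (y - qc (q ^ a))^-1
    = fconst (q ^ (- a)) * (fconst (q ^ (- a)) * y - 1)^-1.
  have -> : y - qc (q ^ a) = (fconst (q ^ (- a)))^-1 * (fconst (q ^ (- a)) * y - 1).
    by rewrite mulrBr mulr1 mulKf // -fmorphV invr_expz opprK.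
  by rewrite invfM invrK.
apply: (relM has_good_pfrac_rel (b := 0) (d := 0)); first exact/has_good_pfrac_const/good_coef_qz.
by have := @has_pfrac_pole _ _ (@fconst (ratq k)) q y _ good_coefP (- a) 0; rewrite expr1.
Qed.

Lemma has_good_pfrac_Pprod_inv r (l : 'I_r -> int) : has_good_pfrac (Pprod k l)^-1.
Proof.
rewrite /Pprod -prodfV.
apply: (@rel_prod _ _ _ has_good_pfrac_rel _ _ _ _ (fun=> 0)) => i _.
exact: has_good_pfrac_poleV.
Qed.

Lemma pfrac_valE (d : pfrac k) :
  pfrac_val d = pfrac_sum (@fconst (ratq k)) q y d.
Proof. exact (erefl (pfrac_val d)). Qed.

Lemma pfrac_RE n (d : pfrac k) : pfrac_R n d =
  pfrac_eval (fun i => if i == 0 then n%:R else 0)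
    (fun t => n%:R * (map_poly intr (W n t.2.+1)).[y ^+ n] / (y ^+ n - 1) ^+ t.2.+1) d.
Proof. exact (erefl (pfrac_R n d)). Qed.

Lemma pfrac_R_inj n (d e : pfrac k) :
  pfrac_val d = pfrac_val e -> pfrac_R n d = pfrac_R n e.
Proof.
rewrite !pfrac_valE !pfrac_RE; apply: pfrac_transfer (qv_neq0 k) qv_expz_neq1.
Qed.

(** [R_eps] picks some decomposition by choice; independence of partial fractions allows computing
    with any other. *)
Lemma R_epsE n (d : pfrac k) : R_eps n (pfrac_val d) = pfrac_R n d.
Proof.
apply: pfrac_R_inj.
exact: (@xgetI _ _ [set e | pfrac_val e = pfrac_val d] d).
Qed.

Lemma R_eps0 n : R_eps n 0 = 0 :> ratqy k.
Proof.
have e : pfrac_val ([::], [::] : seq (int * nat * ratq k)) = 0 :> ratqy k.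
  by rewrite /pfrac_val !big_nil addr0.
by rewrite -e R_epsE /pfrac_R !big_nil addr0.
Qed.

End REps.

(** * R_{n,eps} as a sum over the orbit of η under the n-th roots of unity *)

Section RepsSpecialisation.
Variables (k L : fieldType) (h : {rmorphism k -> L}) (n : nat) (z : L).
Hypothesis z_prim : n.-primitive_root z.
Local Notation q := (qv k).
Local Notation y := (yv k).
Local Notation eta := ('X%:F : {fraction {poly L}}).

Let z0 : z != 0 := prim_root_neq0 z_prim.
Let n0 : (0 < n)%N := prim_order_gt0 z_prim.
Let w : {fraction {poly L}} := fconst z.
Let wP : n.-primitive_root w.
Proof. by rewrite /w (fmorph_primitive_root (@fconst L)). Qed.

Definition orbit_sum (g : {fraction {poly L}}) : {fraction {poly L}} :=
  \sum_(j < n) scale_frac (z ^ j%:Z) g.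

(** At q = z, r becomes the trace of rho_n(f(y)), whose diagonal entries are f(z^j η). *)
Definition orbit_spec (f r : ratqy k) : Prop :=
  exists2 g, yspec h z f g & yspec h z r (orbit_sum g).

Lemma orbit_sumD f g : orbit_sum (f + g) = orbit_sum f + orbit_sum g.
Proof.
rewrite /orbit_sum -big_split; apply: eq_bigr => j _ /=.
exact: (rmorphD (scale_morph (expfz_neq0 j%:Z z0))).
Qed.

Lemma orbit_sum_const c g : orbit_sum (fconst c * g) = fconst c * orbit_sum g.
Proof.
rewrite /orbit_sum mulr_sumr; apply: eq_bigr => j _.
have zj := expfz_neq0 j%:Z z0.
rewrite -[scale_frac _ _]/(scale_morph zj _) (rmorphM (scale_morph zj)).
by rewrite [X in X * _]scale_frac_const.
Qed.

Lemma orbit_spec0 : orbit_spec 0 0.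
Proof.
exists 0; first exact: (rel0 (yspecP h z)).
have -> : orbit_sum 0 = 0; last exact: (rel0 (yspecP h z)).
by rewrite -(mul0r 0) -(rmorph0 (@fconst L)) orbit_sum_const (rmorph0 (@fconst L)) !mul0r.
Qed.

Lemma orbit_specD f r f' r' :
  orbit_spec f r -> orbit_spec f' r' -> orbit_spec (f + f') (r + r').
Proof.
move=> [g fg rg] [g' fg' rg']; exists (g + g'); first exact: (relD (yspecP h z)).
by rewrite orbit_sumD; apply: (relD (yspecP h z)).
Qed.

Lemma orbit_specZ c c' f r : qspec h z c c' ->
  orbit_spec f r -> orbit_spec (qc c * f) (qc c * r).
Proof.
move=> cc [g fg rg]; exists (fconst c' * g).
  by apply: (relM (yspecP h z)) => //; apply: yspec_const.
rewrite orbit_sum_const; apply: (relM (yspecP h z)) => //.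
exact: yspec_const.
Qed.

Let fconstXz (a b : int) : fconst (z ^ a) ^ b = (w ^ a) ^ b.
Proof. by rewrite /w (fmorphXz (@fconst L)). Qed.

Lemma orbit_spec_yz (i : int) : (`|i| < n)%N ->
  orbit_spec (y ^ i) (if i == 0 then n%:R else 0).
Proof.
move=> i_n; exists (eta ^ i).
  exact: (yspec_expz _ (fracX_neq0 L) (yspec_y h z)).
have -> : orbit_sum (eta ^ i) = if i == 0 then n%:R else 0.
  transitivity (eta ^ i * \sum_(j < n) (w ^ j%:Z) ^ i).
    rewrite mulr_sumr; apply: eq_bigr => j _.
    have zj := expfz_neq0 j%:Z z0.
    rewrite -[scale_frac _ _]/(scale_morph zj _) (fmorphXz (scale_morph zj)).
    by rewrite [X in X ^ i]scale_fracX // expfzMl fconstXz mulrC.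
  rewrite sum_prim_root_expz //; case: eqP => [->|_]; last by rewrite mulr0.
  by rewrite expr0z mul1r.
by case: ifP => _; [apply: (rel_nat (yspecP h z))|apply: (rel0 (yspecP h z))].
Qed.

Let etan_neq1 : eta ^+ n - 1 != 0.
Proof.
by rewrite -tofracXn -tofrac1 -tofracB tofrac_eq0 -size_poly_eq0 size_XnsubC.
Qed.

Lemma yspec_yn : yspec h z (y ^+ n) (eta ^+ n).
Proof. exact/(rel_exp (yspecP h z))/yspec_y. Qed.

(** With x = z^i η one has x^n = η^n, which explains why R_{n,eps} of a pole does not depend on
    i. *)
Lemma orbit_spec_pole (i : int) j :
  orbit_spec ((qc (q ^ i) * y - 1) ^+ j.+1)^-1
    (n%:R * (map_poly intr (W n j.+1)).[y ^+ n] / (y ^+ n - 1) ^+ j.+1).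
Proof.
have yP := yspecP h z.
exists ((fconst (z ^ i) * eta - 1) ^+ j.+1)^-1.
  apply: yspecV; first exact/expf_neq0/pole_frac_neq0.
  apply/(rel_exp yP)/(relD yP); last exact/(relN yP)/(rel1 yP).
  by apply: (relM yP); [apply/yspec_const/qspec_qz|apply: yspec_y].
have -> : orbit_sum ((fconst (z ^ i) * eta - 1) ^+ j.+1)^-1
    = n%:R * (map_poly intr (W n j.+1)).[eta ^+ n] / (eta ^+ n - 1) ^+ j.+1.
  pose x := fconst (z ^ i) * eta.
  have xn : x ^+ n = eta ^+ n.
    have zin : (z ^ i) ^+ n = 1.
      by rewrite exprnP exprz_exp mulrC -exprz_exp -exprnP (prim_expr_order z_prim)
        exp1rz.
    by rewrite /x exprMn -(rmorphXn (@fconst L)) zin (rmorph1 (@fconst L)) mul1r.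
  rewrite W_eq // -xn -(sum_prim_root_inv j.+1 wP); last first.
    by rewrite xn -subr_eq0.
  apply: eq_bigr => t _; have zt := expfz_neq0 t%:Z z0.
  rewrite -[scale_frac _ _]/(scale_morph zt _) (fmorphV (scale_morph zt)).
  rewrite (rmorphXn (scale_morph zt)) (rmorphB (scale_morph zt)).
  rewrite (rmorph1 (scale_morph zt)) (rmorphM (scale_morph zt)).
  rewrite [X in X * _]scale_frac_const // [X in _ * X]scale_fracX //.
  by rewrite mulrCA (rmorphXn (@fconst L)).
apply: (relM yP); first apply: (relM yP); first exact: (rel_nat yP).
  exact/(rel_horner_int _ yP)/yspec_yn.
apply: yspecV; first exact: expf_neq0.
apply/(rel_exp yP)/(relD yP); last exact/(relN yP)/(rel1 yP).
exact: yspec_yn.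
Qed.

End RepsSpecialisation.

Lemma eventually_all (T : eqType) (s : seq T) (Q : T -> nat -> Prop) :
  {in s, forall x, exists C : nat, forall n, (C < n)%N -> Q x n} ->
  exists C : nat, forall n, (C < n)%N -> {in s, forall x, Q x n}.
Proof.
elim: s => [|x s IHs] sQ; first by exists 0%N.
have [C CP] := IHs (fun y ys => sQ y (mem_behead (s := x :: s) ys)).
have [D DP] := sQ x (mem_head x s).
exists (maxn C D) => n; rewrite gtn_max => /andP[Cn Dn] y.
by rewrite inE => /predU1P[->|ys]; [apply: DP|apply: CP].
Qed.

Section REpsGood.
Variable k : fieldType.
Hypothesis char0 : [pchar k] =i pred0.

Let coef_at (c : ratq k) n := exists p b : {poly k},
  coprimep b (Phi k n) /\ c = p%:F / b%:F.

Let coef_at_qspec (L : fieldType) (h : {rmorphism k -> L}) z c n :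
  coef_at c n -> root (map_poly h (Phi k n)) z -> exists c', qspec h z c c'.
Proof.
move=> [p [b [bP ->]]] zP; exists (qeval h z p / qeval h z b); exists p, b; split=> //.
move: bP; rewrite coprimep_sym -(coprimep_map h) => /coprimep_root.
by apply.
Qed.

(** A partial fraction of f involves finitely many exponents and coefficients, so one threshold
    serves them all, uniformly in L and z. *)
Lemma R_eps_spec f : has_good_pfrac f -> exists C : nat, forall n, (C < n)%N ->
  Phi_integral n (R_eps n f) /\
  forall (L : fieldType) (h : {rmorphism k -> L}) (z : L),
    root (map_poly h (Phi k n)) z -> orbit_spec h n z f (R_eps n f).
Proof.
move=> [d [d1 d2] dE].
have [C1 C1P] : exists C : nat, forall n, (C < n)%N ->
    {in d.1, forall x, (`|x.1| < n)%N /\ coef_at x.2 n}.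
  apply: eventually_all => x xd; have [p [b [[C CP] xE]]] := d1 x xd.
  exists (maxn C `|x.1|) => n; rewrite gtn_max => /andP[Cn xn]; split=> //.
  by exists p, b; split=> //; apply: CP.
have [C2 C2P] : exists C : nat, forall n, (C < n)%N -> {in d.2, forall x, coef_at x.2 n}.
  apply: eventually_all => x xd; have [p [b [[C CP] xE]]] := d2 x xd.
  by exists C => n Cn; exists p, b; split=> //; apply: CP.
rewrite -pfrac_valE in dE.
case: _ / dE; exists (maxn C1 C2) => n Cn.
have n0 : (0 < n)%N by apply: leq_ltn_trans Cn.
move: Cn; rewrite gtn_max => /andP[/C1P{}C1P /C2P{}C2P].
rewrite R_epsE; split.
  have IM (a b : ratqy k) : Phi_integral n a -> Phi_integral n b -> Phi_integral n (a * b).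
    by move=> aI bI; exact: (@relM _ _ _ (integralP k n0) a 0 b 0 aI bI).
  have ID (a b : ratqy k) : Phi_integral n a -> Phi_integral n b -> Phi_integral n (a + b).
    by move=> aI bI; exact: (@relD _ _ _ (integralP k n0) a 0 b 0 aI bI).
  have I0 : Phi_integral n (0 : ratqy k) := rel0 (integralP k n0).
  have In m : Phi_integral n (m%:R : ratqy k) := rel_nat (integralP k n0) m.
  have Ic c : coef_at c n -> Phi_integral n (qc c).
    by move=> [p [b [bP ->]]]; apply: integral_const.
  apply: (ID _ _); rewrite big_seq; apply: (big_ind (Phi_integral n)) => // x xd.
    have [_ xc] := C1P x xd; apply: (IM _ _); first exact: Ic.
    by case: ifP.
  apply: (IM _ _); first exact/Ic/C2P.
  apply: (IM _ _); last exact: integral_ynV.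
  apply: (IM _ _); first exact: In.
  have ynI : Phi_integral n (yv k ^+ n) := integral_yz k n n.
  exact: (@rel_horner_int _ _ _ (W n x.1.2.+1) (yv k ^+ n) 0 (integralP k n0) ynI).
move=> L h z zP; have zprim := root_Phi_prim char0 n0 zP.
have O0 := orbit_spec0 h zprim; have OD := @orbit_specD _ _ h n z zprim.
rewrite /pfrac_val /pfrac_R; apply: (OD _ _ _ _); rewrite !big_seq;
  apply: (big_ind2 (orbit_spec h n z)) => // x xd.
  have [xn /coef_at_qspec /(_ zP) [c' xc]] := C1P x xd.
  by apply: orbit_specZ xc _ => //; apply: orbit_spec_yz.
have /coef_at_qspec /(_ zP) [c' xc] := C2P x xd.
by apply: orbit_specZ xc _ => //; apply: orbit_spec_pole.
Qed.

End REpsGood.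

(** * Integrality *)

(** Each factor is -x (c/x - w^j), and the product of the c/x - w^j is X^n - 1 evaluated at c/x. The
    sign (-1)^(n-1) of the theorem originates here. *)
Lemma prod_prim_root_sub (K : fieldType) n (w x c : K) :
  n.-primitive_root w -> x != 0 -> c ^+ n = 1 ->
  \prod_(j < n) (w ^+ j * x - c) = (-1) ^+ n.-1 * (x ^+ n - 1).
Proof.
move=> wP x0 cn; have n0 := prim_order_gt0 wP.
transitivity ((- x) ^+ n * \prod_(j < n) (c / x - w ^+ j)).
  have <- : \prod_(j < n) - x = (- x) ^+ n by rewrite prodr_const card_ord.
  rewrite -big_split; apply: eq_bigr => j _ /=.
  by rewrite mulrBr !mulNr opprK addrC mulrCA mulfV // mulr1 [x * _]mulrC.
have -> : \prod_(j < n) (c / x - w ^+ j) = (c / x) ^+ n - 1.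
  have /(congr1 (fun p => p.[c / x])) := factor_Xn_sub_1 wP.
  rewrite big_mkord horner_prod hornerD hornerN hornerXn hornerC => <-.
  by apply: eq_bigr => j _; rewrite hornerXsubC.
have xn0 : x ^+ n != 0 by rewrite expf_neq0.
rewrite expr_div_n cn [(- x) ^+ n]exprNn -mulrA.
have -> : x ^+ n * (1 / x ^+ n - 1) = - (x ^+ n - 1).
  by rewrite mulrBr mulr1 mulrC divfK // opprB.
by rewrite -{1}(prednK n0) exprSr mulrN1 mulrNN.
Qed.

Section CoefficientClosure.
Variable k : fieldType.
Hypothesis char0 : [pchar k] =i pred0.
Local Notation q := (qv k).
Local Notation y := (yv k).

Section Integral.
Variable n : nat.
Hypothesis n_gt0 : (0 < n)%N.

Let IP := integralP k n_gt0.

(** Column j of [rho] applies y -> q^j y to coefficients, and this does not preserve the denominator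
    y^n - 1 allowed in [Phi_integral]. *)
Definition shift_integral (f : ratqy k) : Prop :=
  forall j : int, Phi_integral n (scale_frac (q ^ j) f).

Lemma shift_integralP : ring_rel (fun f _ : ratqy k => shift_integral f).
Proof.
have qj0 (j : int) : q ^ j != 0 by rewrite expfz_neq0 ?qv_neq0.
split.
- by move=> j; rewrite -[scale_frac _ _]/(scale_morph (qj0 j) _) rmorph0; apply: (rel0 IP).
- by move=> j; rewrite -[scale_frac _ _]/(scale_morph (qj0 j) _) rmorph1; apply: (rel1 IP).
- move=> f _ fI j; rewrite -[scale_frac _ _]/(scale_morph (qj0 j) _).
  rewrite (rmorphN (scale_morph (qj0 j))).
  exact: (@relN _ _ _ IP _ 0 (fI j)).
- move=> f _ g _ fI gI j; rewrite -[scale_frac _ _]/(scale_morph (qj0 j) _).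
  rewrite (rmorphD (scale_morph (qj0 j))).
  exact: (@relD _ _ _ IP _ 0 _ 0 (fI j) (gI j)).
- move=> f _ g _ fI gI j; rewrite -[scale_frac _ _]/(scale_morph (qj0 j) _).
  rewrite (rmorphM (scale_morph (qj0 j))).
  exact: (@relM _ _ _ IP _ 0 _ 0 (fI j) (gI j)).
Qed.

Lemma integral_laurent_q (c : ratq k) : is_laurent_q c -> Phi_integral n (qc c).
Proof.
move=> [p [e ->]]; rewrite -tofracXn; apply: integral_const.
exact/coprimep_expl/coprimep_X_Phi.
Qed.

Lemma shift_integral_const c : is_laurent_q c -> shift_integral (fconst c).
Proof.
move=> cP j; rewrite scale_frac_const ?expfz_neq0 ?qv_neq0 //.
exact: integral_laurent_q.
Qed.

Lemma laurent_qz (i : int) : is_laurent_q (q ^ i).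
Proof.
case: i => i; first by exists 'X^i, 0%N; rewrite expr0 divr1 tofracXn.
by exists 1, i.+1; rewrite tofrac1 div1r NegzE -invr_expz.
Qed.

Lemma shift_integral_yz (i : int) : shift_integral (y ^ i).
Proof.
move=> j; have qj0 : q ^ j != 0 by rewrite expfz_neq0 ?qv_neq0.
rewrite -[scale_frac _ _]/(scale_morph qj0 _) (fmorphXz (scale_morph qj0)).
rewrite [X in X ^ i]scale_fracX // expfzMl -(fmorphXz (@fconst (ratq k))) exprz_exp.
apply: (@relM _ _ _ IP _ 0 _ 0); last exact: (integral_yz k n i).
exact/integral_laurent_q/laurent_qz.
Qed.

Lemma shift_integral_laurent N f : is_laurent_qy N f -> shift_integral f.
Proof.
case/laurent_qyE=> p pP ->; rewrite /laurent_eval.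
apply: (@relM _ _ _ shift_integralP _ 0 _ 0); last exact: shift_integral_yz.
apply: (@rel_sum _ _ _ shift_integralP _ _ _ _ (fun=> 0)) => i _.
apply: (@relM _ _ _ shift_integralP _ 0 _ 0); last exact: shift_integral_yz.
exact: shift_integral_const.
Qed.

Lemma shift_integral_Pprod r (l : 'I_r -> int) : shift_integral (Pprod k l).
Proof.
apply: (@rel_prod _ _ _ shift_integralP _ _ _ _ (fun=> 0)) => i _.
apply: (@relD _ _ _ shift_integralP _ 0 _ 0); first exact: (shift_integral_yz 1).
apply: (@relN _ _ _ shift_integralP _ 0); exact/shift_integral_const/laurent_qz.
Qed.

Lemma integral_natV r : Phi_integral n (r%:R^-1 : ratqy k).
Proof.
have -> : r%:R^-1 = qc ((r%:R^-1)%:P%:F / (1 : {poly k})%:F) :> ratqy k.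
  rewrite tofrac1 divr1 -[qc _]/(fconst _) -[(_%:P)%:F]/(fconst _).
  by rewrite !fmorphV !rmorph_nat.
by apply: integral_const; apply: coprime1p.
Qed.

Lemma integral_texp (S : tseries (ratqy k)) M : tcoef S 0 = 0 ->
  (forall m, (m < M)%N -> Phi_integral n (tcoef S m)) ->
  forall m, (m < M)%N -> Phi_integral n (tcoef (texp S) m).
Proof.
move=> S0 SI m; have [m0] := ubnP m; elim: m0 m => // m0 IH [|m] /ltnSE mm0 mM.
  by rewrite texp0; apply: (rel1 IP).
rewrite -(natr_mulVK (tcoef (texp S) m.+1) m (pchar_qy char0)).
rewrite texp_rec //; apply: (@relM _ _ _ IP _ 0 _ 0); first exact: integral_natV.
apply: (@rel_sum _ _ _ IP _ _ _ _ (fun=> 0)) => i _; have im := ltn_ord i.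
apply: (@relM _ _ _ IP _ 0 _ 0); first by apply: IH; lia.
by apply: (@relMn _ _ _ IP _ 0); apply: SI; lia.
Qed.

End Integral.

End CoefficientClosure.

(** * The specialised determinant *)

Lemma lcoef_xi0 (k : fieldType) (S : tseries (ratqy k)) m a :
  lcoef (tcoef (xi0 S) m) a = if a == 0 then tcoef S m else 0.
Proof. by []. Qed.

Section SpecialisedDeterminant.
Variables (k L : fieldType) (h : {rmorphism k -> L}) (n : nat) (z : L).
Hypothesis char0 : [pchar k] =i pred0.
Hypothesis z_root : root (map_poly h (Phi k n)) z.
Hypothesis n_gt0 : (0 < n)%N.
Local Notation q := (qv k).
Local Notation y := (yv k).
Local Notation E := {fraction {poly L}}.
Local Notation eta := ('X%:F : E).

Let zP : n.-primitive_root z := root_Phi_prim char0 n_gt0 z_root.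
Let z0 : z != 0 := prim_root_neq0 zP.
Let tau : twist E := scale_twist z0.
Let yP := yspecP h z.

Let charE : [pchar E] =i pred0.
Proof.
apply: pchar_frac; apply/pcharf0P => i; have /pcharf0P <- := char0.
by rewrite -(rmorph_nat h) fmorph_eq0.
Qed.

Let tau_n c : tau n%:Z c = c.
Proof. by rewrite /= -exprnP (prim_expr_order zP) scale_frac_id. Qed.

Let tau_spec b c d : yspec h z c d -> yspec h z (qtwist k b c) (tau b d).
Proof. exact: yspec_scale. Qed.

(** A total version of specialisation, with value 0 where there is none, so that it can be applied
    to all coefficients of a series. Those of Q do specialise, by [Q_ring]. *)
Definition yspec_choice (f : ratqy k) : E := xget 0 [set g | yspec h z f g].

Lemma yspec_choiceP f g : yspec h z f g -> yspec h z f (yspec_choice f).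
Proof. by move=> fg; apply: (@xgetI _ _ [set g | yspec h z f g] g). Qed.

Lemma yspec_choice0 : yspec_choice 0 = 0.
Proof.
have y0 : yspec h z 0 0 := rel0 yP.
exact: yspec_inj (yspec_choiceP y0) y0.
Qed.

Fact lspec_subproof (f : laurent (qtwist k)) : exists N : int, forall a : int,
  a < N -> yspec_choice (lcoef f a) = 0.
Proof.
by have [N fN] := lcoef_bounded f; exists N => a /fN ->; apply: yspec_choice0.
Qed.

Definition tspec (F : qseries k) : tseries (laurent tau) :=
  TSeries (fun m => Laurent tau (lspec_subproof (tcoef F m))).

Let srel : qseries k -> tseries (laurent tau) -> Prop :=
  tseries_rel (@laurent_rel _ _ (qtwist k) tau (yspec h z)).

Let srelP : ring_rel srel := tseries_relP (laurent_relP yP tau_spec).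

Let srel_const c d : yspec h z c d ->
  srel (qseries_const c) (tconst (lconst tau d)).
Proof.
move=> cd m a /=; case: (m == 0%N) => /=; first case: (a == 0) => //.
  exact: (rel0 yP).
by rewrite !if_same; apply: (rel0 yP).
Qed.

Lemma laurent_q_spec c : is_laurent_q c -> exists d, qspec h z c d.
Proof.
move=> [p [e ->]]; exists (qeval h z p / z ^+ e).
apply: (relM (qspecP h z)); first exact: place_iota.
apply: placeV; first exact: expf_neq0.
exact/(rel_exp (qspecP h z))/qspec_q.
Qed.

Lemma laurent_qy_spec N f : is_laurent_qy N f -> exists g, yspec h z f g.
Proof.
case/laurent_qyE=> p pP ->.
have yz (i : int) : yspec h z (y ^ i) (eta ^ i).
  exact: (yspec_expz _ (fracX_neq0 L) (yspec_y h z)).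
have [c cP] := boolp.choice (fun i => laurent_q_spec (pP i)).
exists ((\sum_(i < size p) fconst (c i) * eta ^ i%:Z) * eta ^ (- N%:Z)).
apply: (relM yP) (yz _); apply: (rel_sum yP) => i _.
by apply: (relM yP) (yz _); apply: yspec_const.
Qed.

Lemma det_rho_spec F F' : srel F F' ->
  tseries_rel (@laurent_rel _ _ (notwist (ratqy k)) (notwist E) (yspec h z))
    (\det (rho n F)) (\det (mrho n F')).
Proof.
have nP : ring_rel (tseries_rel
    (@laurent_rel _ _ (notwist (ratqy k)) (notwist E) (yspec h z))).
  exact: (tseries_relP (@laurent_relP _ _ (notwist _) (notwist _) _ yP (fun _ _ _ => id))).
move=> FF; apply: (rel_det nP).
move=> i j; rewrite !mxE => m a /=; case: ifP => _; last exact: (rel0 yP).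
exact: (tau_spec _ (FF m a)).
Qed.

Variables (r : nat) (l : 'I_r -> int).

Definition Pprod_spec : E := \prod_(i < r) (eta - fconst (z ^ l i)).

Lemma Pprod_specP : yspec h z (Pprod k l) Pprod_spec.
Proof.
apply: (rel_prod yP) => i _; apply: (relD yP); first exact: yspec_y.
exact/(relN yP)/yspec_const/qspec_qz.
Qed.

Lemma Pprod_spec_neq0 : Pprod_spec != 0.
Proof.
apply/prodf_neq0 => i _.
by rewrite -[fconst _]/((_%:P)%:F) -tofracB tofrac_eq0 polyXsubC_eq0.
Qed.

(** This is det rho(P). All r factors contribute equally, since (z^(l_i))^n = 1. *)
Lemma orbit_prod_Pprod :
  \prod_(j < n) tau j%:Z Pprod_spec = (-1) ^+ (r * n.-1) * (eta ^+ n - 1) ^+ r.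
Proof.
under eq_bigr do rewrite rmorph_prod.
rewrite exchange_big mulnC exprM -exprMn.
rewrite (eq_bigr (fun=> (-1) ^+ n.-1 * (eta ^+ n - 1))).
  by rewrite prodr_const card_ord.
move=> i _; rewrite -(prod_prim_root_sub (w := fconst z) (c := fconst (z ^ l i))).
- apply: eq_bigr => j _; rewrite (rmorphB (tau j%:Z)); congr (_ - _).
    by rewrite /= scale_fracX ?expfz_neq0 // -exprnP (rmorphXn (@fconst L)).
  by rewrite /= scale_frac_const ?expfz_neq0.
- by rewrite (fmorph_primitive_root (@fconst L)).
- exact: fracX_neq0.
rewrite -(rmorphXn (@fconst L)) exprnP exprz_exp mulrC -exprz_exp -exprnP.
by rewrite (prim_expr_order zP) exp1rz rmorph1.
Qed.

Variable Q : qseries k.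
Hypothesis Q_t : tcoef Q 0 = 0.
Hypothesis Q_ring : forall m : nat, laurent_xy (tcoef Q m).
Variables (P : nat -> int -> Prop) (Z : int -> Prop) (M : nat).
Hypothesis P0 : P 0%N 0.
Hypothesis PD : forall m m' a a', P m a -> P m' a' -> P (m + m')%N (a + a').
Hypothesis Zpos : forall a, Z a -> 0 < a.
Hypothesis ZD : forall a b, Z a -> Z b -> Z (a + b).
Hypothesis PZ : forall m a, (m < M)%N -> P m a -> (n%:Z %| a)%Z -> a = 0 \/ Z a.

Let G : qseries k := qseries_const (Pprod k l)^-1 * Q.
Hypothesis GP : supported P M G.
Hypothesis R_spec : forall m, (m < M)%N ->
  orbit_spec h n z (coef_x_eps (tcoef (log1p G) m))
    (R_eps n (coef_x_eps (tcoef (log1p G) m))).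

Let Qs := tspec Q.
(** Built from the specialised Q instead of as [tspec G], so that P (1 + Gs) = P + Qs holds
    exactly. *)
Let Gs : tseries (laurent tau) := tconst (lconst tau Pprod_spec^-1) * Qs.

Let QQs : srel Q Qs.
Proof.
move=> m a; have [N QN] := Q_ring m; have [g Qg] := laurent_qy_spec (QN a).
exact: yspec_choiceP Qg.
Qed.

Let GGs : srel G Gs.
Proof.
apply: (relM srelP) QQs; apply: srel_const.
exact: yspecV Pprod_spec_neq0 Pprod_specP.
Qed.

Let Gs0 : tcoef Gs 0 = 0.
Proof.
rewrite tcoefM0 [X in _ * X](_ : _ = 0) ?mulr0 //.
apply: laurentP => a; rewrite lcoef0 /= Q_t lcoef0; exact: yspec_choice0.
Qed.

Let GsP : supported P M Gs.
Proof.
move=> m a mM Gsa; apply: (GP mM) => Ga0; apply: Gsa.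
apply: (yspec_inj (GGs m a)); rewrite Ga0; exact: (rel0 yP).
Qed.

Lemma coef_log1p (F : qseries k) m :
  coef_x_eps (tcoef (log1p F) m) = log1p_coef0 F m.
Proof.
rewrite /coef_x_eps /rho_eps tw0 subr0 /log1p_coef0 [tcoef _ _]/= lcoef_sum.
by apply: eq_bigr => i _; rewrite lcoef_constM tw0.
Qed.

Let det m := tcoef (\det (1%:M + mrho n Gs)) m.
Let S := TSeries (fun m => R_eps n (coef_x_eps (tcoef (log1p G) m))).
Let s m := \sum_(j < n) tau j%:Z (log1p_coef0 Gs m).

Let S_spec m : (m < M)%N -> yspec h z (tcoef S m) (s m).
Proof.
move=> /R_spec[g Gg Rg]; rewrite /s.
suff <- : g = log1p_coef0 Gs m by exact: Rg.
rewrite coef_log1p in Gg; apply: yspec_inj Gg _; apply: (rel_sum yP) => i _.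
apply: (relM yP); last exact: (rel_exp srelP _ GGs).
by apply: (relM yP); [apply: (rel_sign yP)|apply: yspec_natV].
Qed.

Let S0 : tcoef S 0 = 0.
Proof.
by rewrite /= coef_log1p /log1p_coef0 big_geq // R_eps0.
Qed.

(** [texp_rec] and [leading_det1p_mrho] are the same recursion with the same initial value, and
    [S_spec] matches their inputs. *)
Let texp_spec m : (m < M)%N -> yspec h z (tcoef (texp S) m) (lcoef (det m) 0).
Proof.
have [m0] := ubnP m; elim: m0 m => // m0 IH [|m] /ltnSE mm0 mM.
  rewrite texp0 /det (det1p_mrho0 n Gs0) lcoef1.
  exact: (rel1 yP).
rewrite -(natr_mulVK (tcoef (texp S) m.+1) m (pchar_qy char0)) (texp_rec char0 _ S0).
rewrite -(natr_mulVK (lcoef (det m.+1) 0) m charE).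
have [_ ->] := leading_det1p_mrho charE n_gt0 tau_n P0 PD Zpos ZD PZ Gs0 GsP mM.
apply: (relM yP); first exact: yspec_natV.
apply: (rel_sum yP) => i _; have im := ltn_ord i.
apply: (relM yP); first by apply: IH; lia.
by apply: (relMn yP); apply: S_spec; lia.
Qed.

Lemma det_rho_formula_spec m a : (m < M)%N -> a = 0 \/ ~ Z a ->
  exists2 v, yspec h z
    (lcoef (tcoef (\det (rho n (qseries_const (Pprod k l) + Q))) m) a) v
  & yspec h z (lcoef (tcoef (xi0 (det_formula n l Q)) m) a) v.
Proof.
move=> mM aZ; pose D' := tconst (lconst tau Pprod_spec) + Qs.
have DD' : srel (qseries_const (Pprod k l) + Q) D'.
  by apply: (relD srelP) QQs; apply/srel_const/Pprod_specP.
exists (lcoef (tcoef (\det (mrho n D')) m) a); first exact: det_rho_spec.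
have D'E : D' = tconst (lconst tau Pprod_spec) * (1 + Gs).
  rewrite mulrDr mulr1 /Gs mulrA -tconstM -lconstM mulfV ?Pprod_spec_neq0 //.
  by rewrite lconst1 tconst1 mul1r.
pose c := (-1) ^+ (r * n.-1) * (eta ^+ n - 1) ^+ r.
have -> : lcoef (tcoef (\det (mrho n D')) m) a = c * lcoef (det m) a.
  rewrite D'E (det_mrho_constM n_gt0 tau_n) mrho1p orbit_prod_Pprod.
  by rewrite tcoef_constM lcoef_constM.
have [[detZ _] _] := leading_det1p_mrho charE n_gt0 tau_n P0 PD Zpos ZD PZ Gs0 GsP mM.
rewrite lcoef_xi0; case: eqP => [->|a0]; last first.
  have -> : lcoef (det m) a = 0; last by rewrite mulr0; apply: (rel0 yP).
  by apply: contrapT => /detZ[|Za]; case: aZ.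
rewrite /det_formula tcoef_constM; apply: (relM yP) (texp_spec mM).
apply: (relM yP); first exact: (rel_sign yP).
apply/(rel_exp yP)/(relD yP); last exact/(relN yP)/(rel1 yP).
exact: yspec_yn.
Qed.

End SpecialisedDeterminant.

(** * The determinant formula *)

Section DeterminantFormula.
Variable k : fieldType.
Hypothesis char0 : [pchar k] =i pred0.
Variables (r : nat) (l : 'I_r -> int) (Q : qseries k).
Hypothesis Q_t : tcoef Q 0 = 0.
Hypothesis Q_ring : forall m : nat, laurent_xy (tcoef Q m).

Let D := qseries_const (Pprod k l) + Q.
Let G : qseries k := qseries_const (Pprod k l)^-1 * Q.
Let f m := coef_x_eps (tcoef (log1p G) m).

Lemma has_good_pfrac_coef_log1p m : has_good_pfrac (f m).
Proof.
pose R (a _ : ratqy k) := has_good_pfrac a.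
have RP : ring_rel R := has_good_pfrac_rel char0.
have TP : ring_rel (tseries_rel (@laurent_rel _ _ (qtwist k) (qtwist k) R)).
  apply: tseries_relP; apply: (@laurent_relP _ _ (qtwist k) (qtwist k) R RP).
  by move=> b c d; apply: (has_good_pfrac_scale b).
have GR : tseries_rel (@laurent_rel _ _ (qtwist k) (qtwist k) R) G 0.
  rewrite -(mulr0 0); apply: (relM TP) => u a.
    rewrite /R /=; case: (u == 0%N) => /=; last by rewrite if_same; apply: (rel0 RP).
    by case: (a == 0); [apply: (has_good_pfrac_Pprod_inv char0)|apply: (rel0 RP)].
  by have [N QN] := Q_ring u; apply: (has_good_pfrac_laurent char0 (QN a)).
rewrite /f coef_log1p; apply: (@rel_sum _ _ _ RP _ _ _ _ (fun=> 0)) => i _.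
apply: (@relM _ _ _ RP _ 0 _ 0); last exact: (rel_exp TP i GR m 0).
by apply: (@relM _ _ _ RP _ ((-1) ^+ i.+1) _ 0); [apply: (rel_sign RP)|exact: has_good_pfrac_natV].
Qed.

(** P^(-1) involves neither x nor t, so bounds on the exponents of Q are bounds for G. *)
Lemma lcoef_G_neq0 m a : lcoef (tcoef G m) a <> 0 -> lcoef (tcoef Q m) a <> 0.
Proof.
by rewrite /G tcoef_constM lcoef_constM => GN Q0; apply: GN; rewrite Q0 mulr0.
Qed.

Section Fixed.
Variables (n M : nat).
Hypothesis n_gt0 : (0 < n)%N.
Hypothesis R_int : forall m, (m < M)%N -> Phi_integral n (R_eps n (f m)).
Hypothesis R_spec : forall m, (m < M)%N ->
  forall (L : fieldType) (h : {rmorphism k -> L}) (z : L),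
    root (map_poly h (Phi k n)) z -> orbit_spec h n z (f m) (R_eps n (f m)).

Let IP := integralP k n_gt0.

Lemma integral_det_rho m a : Phi_integral n (lcoef (tcoef (\det (rho n D)) m) a).
Proof.
pose R (b _ : ratqy k) := Phi_integral n b.
have TP : ring_rel (tseries_rel (@laurent_rel _ _ (notwist _) (notwist _) R)).
  by apply: tseries_relP; apply: laurent_relP.
have DI u b : shift_integral n (lcoef (tcoef D u) b).
  have SP := shift_integralP k n_gt0.
  apply: (@relD _ _ _ SP _ 0 _ 0); last first.
    by have [N QN] := Q_ring u; apply: shift_integral_laurent (QN b).
  rewrite /=; case: (u == 0%N) => /=; last by rewrite if_same; apply: (rel0 SP).
  by case: (b == 0); [apply: shift_integral_Pprod|apply: (rel0 SP)].
apply: (rel_det (B := 0) TP _ m a) => i j u b.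
rewrite /R mxE /=; case: ifP => _; [exact: (DI u b j)|exact: (rel0 IP)].
Qed.

Lemma integral_det_formula m a : (m < M)%N ->
  Phi_integral n (lcoef (tcoef (xi0 (det_formula n l Q)) m) a).
Proof.
move=> mM; rewrite lcoef_xi0; case: (a == 0); last exact: (rel0 IP).
rewrite /det_formula tcoef_constM; apply: (@relM _ _ _ IP _ 0 _ 0).
  apply: (@relM _ _ _ IP _ 0 _ 0).
    exact: (@rel_exp _ _ _ IP _ (- 1) _ (@relN _ _ _ IP _ 1 (rel1 IP))).
  apply: (@rel_exp _ _ _ IP _ 0); apply: (@relD _ _ _ IP _ 0 _ 0).
    exact: (integral_yz k n n).
  exact: (@relN _ _ _ IP _ 1 (rel1 IP)).
apply: (integral_texp char0 n_gt0 _ _ mM) => //.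
by rewrite /= coef_log1p /log1p_coef0 big_geq // R_eps0.
Qed.

(** P and Z stay abstract so that both claims of the theorem, below ξ^n and for Q finite in x, are
    instances. *)
Lemma det_rho_congr (P : nat -> int -> Prop) (Z : int -> Prop) m a :
  P 0%N 0 -> (forall u v b c, P u b -> P v c -> P (u + v)%N (b + c)) ->
  (forall b, Z b -> 0 < b) -> (forall b c, Z b -> Z c -> Z (b + c)) ->
  (forall u b, (u < M)%N -> P u b -> (n%:Z %| b)%Z -> b = 0 \/ Z b) ->
  supported P M G -> (m < M)%N -> a = 0 \/ ~ Z a ->
  Phi_congr n (lcoef (tcoef (\det (rho n D)) m) a)
    (lcoef (tcoef (xi0 (det_formula n l Q)) m) a).
Proof.
move=> P0 PD Zpos ZD PZ GP mM aZ.
apply: Phi_congrP => //; [exact: integral_det_rho|exact: integral_det_formula|].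
move=> L h z zP; apply: (det_rho_formula_spec char0 zP n_gt0 Q_t Q_ring P0 PD
  Zpos ZD PZ GP _ mM aZ) => u uM; exact: R_spec.
Qed.

End Fixed.
End DeterminantFormula.

Lemma eventually_lt M (Q : nat -> nat -> Prop) :
  (forall m, (m < M)%N -> exists C : nat, forall n, (C < n)%N -> Q m n) ->
  exists C : nat, forall n, (C < n)%N -> forall m, (m < M)%N -> Q m n.
Proof.
move=> QM; have [|C CP] := @eventually_all _ (iota 0 M) Q.
  by move=> m; rewrite mem_iota => /QM.
by exists C => n Cn m mM; apply: CP; rewrite ?mem_iota.
Qed.

Theorem theorem5p2 (k : fieldType) (char0 : [pchar k] =i pred0)
    (r : nat) (l : 'I_r -> int) (Q : qseries k)
    (Q_t : tcoef Q 0 = 0) (Q_ring : forall m : nat, laurent_xy (tcoef Q m)) :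
  let D := qseries_const (Pprod k l) + Q in
  forall M : nat, (1 <= M)%N -> exists C : nat, forall n : nat, (C < n)%N ->
    eq_mod n M [set a : int | a < n%:Z]
      (\det (rho n D)) (xi0 (det_formula n l Q)) /\
    ((forall m : nat, (m < M)%N -> finite_in_x (tcoef Q m)) ->
      eq_mod n M [set: int] (\det (rho n D)) (xi0 (det_formula n l Q))).
Proof.
move=> D M _.
have [C RP] := eventually_lt (M := M)
  (fun m _ => R_eps_spec char0 (has_good_pfrac_coef_log1p char0 l Q_ring m)).
have [A AP] : exists A : nat, forall n, (A < n)%N -> forall m, (m < M)%N ->
    forall a, lcoef (tcoef Q m) a <> 0 -> - n%:Z <= a.
  apply: eventually_lt => m _; have [N QN] := lcoef_bounded (tcoef Q m).
  exists `|N|%N => n Nn a Qa; rewrite leNgt; apply/negP => an.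
  by apply/Qa/QN; lia.
(* Finiteness stays a premise of the bound: the threshold has to be fixed before it is known whether
   Q is finite in x. *)
have [B BP] : exists B : nat, (forall m, (m < M)%N -> finite_in_x (tcoef Q m)) ->
    forall n, (B < n)%N -> forall m, (m < M)%N ->
    forall a, lcoef (tcoef Q m) a <> 0 -> a <= n%:Z.
  have [fin|nfin] := pselect (forall m, (m < M)%N -> finite_in_x (tcoef Q m)).
    have [B BP] : exists B : nat, forall n, (B < n)%N -> forall m, (m < M)%N ->
        forall a, lcoef (tcoef Q m) a <> 0 -> a <= n%:Z.
      apply: eventually_lt => m mM; have [N QN] := fin m mM.
      exists `|N|%N => n Nn a Qa; rewrite leNgt; apply/negP => an.
      by apply/Qa/QN; lia.
    by exists B.
  by exists 0%N => /nfin.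
(* The bounds hold for integers strictly above A and B; [N] is one such integer. *)
pose N := (A + B).+1.
(* Beyond C, [R_eps] behaves at every t^m with m < M; beyond M N, n exceeds every x-exponent bound m
   N. *)
exists (C + M * N)%N => n Cn.
have n0 : (0 < n)%N by lia.
have RI m mM := proj1 (RP n (leq_ltn_trans (leq_addr _ _) Cn) m mM).
have RS m mM := proj2 (RP n (leq_ltn_trans (leq_addr _ _) Cn) m mM).
have small m (a : int) : (m < M)%N -> - (m * N)%:Z <= a -> (n%:Z %| a)%Z ->
    a < n%:Z -> a = 0.
  move=> mM am /dvdzP[b aE] an; have mN : (m * N <= M * N)%N by rewrite leq_mul2r ltnW ?orbT.
  have MNn : (M * N < n)%N by apply: leq_ltn_trans Cn; apply: leq_addl.
  move: (m * N)%N (M * N)%N am mN MNn => u v am mN MNn.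
  case: (ltgtP b 0) => [b0|b0|b0]; last by rewrite aE b0 mul0r.
    have : b * n%:Z <= - n%:Z by nia.
    by lia.
  have : n%:Z <= b * n%:Z by nia.
  by lia.
(* G has no t^0 term, so the constant bound N on its exponents can be weakened to the additive bound
   m N. *)
have GP0 m a : lcoef (tcoef (qseries_const (Pprod k l)^-1 * Q) m) a <> 0 ->
    (0 < m)%N.
  by move=> /lcoef_G_neq0; case: m => // []; rewrite Q_t lcoef0.
split=> [m a mM an|fin m a mM _].
  apply: (det_rho_congr char0 Q_t Q_ring n0 RI RS (P := fun m a => - (m * N)%:Z <= a)
    (Z := fun a => n%:Z <= a)) => //.
  - by move=> u v b c ub vc; rewrite mulnDl; lia.
  - by move=> b; lia.
  - by move=> b c; lia.
  - move=> u b uM ub nb; have [|bn] := leP n%:Z b; first by right.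
    by left; apply: (small u).
  - move=> u b uM Gb; have u0 := GP0 _ _ Gb.
    have := AP N _ u uM b (lcoef_G_neq0 Gb); rewrite /N ltnS leq_addr => /(_ isT).
    have : (N <= u * N)%N by rewrite leq_pmull.
    by rewrite /N; lia.
  by right; apply/negP; rewrite -ltNge.
apply: (det_rho_congr char0 Q_t Q_ring n0 RI RS
  (P := fun m a => - (m * N)%:Z <= a /\ a <= (m * N)%:Z) (Z := fun=> False)) => //.
- by move=> u v b c [ub bu] [vc cv]; rewrite mulnDl; split; lia.
- move=> u b uM [ub bu] nb; left; apply: (small u) => //.
  have : (u * N <= M * N)%N by rewrite leq_mul2r ltnW ?orbT.
  by lia.
- move=> u b uM Gb; have u0 := GP0 _ _ Gb; have Qb := lcoef_G_neq0 Gb.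
  have := AP N _ u uM b Qb; have := BP fin N _ u uM b Qb.
  rewrite /N !ltnS leq_addr leq_addl => /(_ isT) + /(_ isT).
  have : (N <= u * N)%N by rewrite leq_pmull.
  by rewrite /N; split; lia.
by right.
Qed.
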